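(* Let $\mathbb{F}$ be a countable field and let $E$ be a vector space over $\mathbb{F}$ of dimension $\aleph_0$ with a fixed Hamel basis $(e_n)_{n<\omega}$. Then there exists a completely separable mad family $\mathcal{A}\subseteq E^{[\infty]}$ of block subspaces, i.e. a mad family $\mathcal{A}\subseteq E^{[\infty]}$ such that for every $Y\subseteq E$ with $\langle Y\rangle\in\mathcal{I}^{++}(\mathcal{A})$ there exists $A\in\mathcal{A}$ with $\langle A\rangle\subseteq\langle Y\rangle$.
   Context: For $x=\sum_n\lambda_n e_n\in E$ let $\mathrm{supp}(x)=\{n:\lambda_n\neq 0\}$; for nonzero $x,y$ write $x<y$ iff $\max\mathrm{supp}(x)<\min\mathrm{supp}(y)$. A block sequence is a $<$-increasing sequence of nonzero vectors; $E^{[\infty]}$ denotes the set of infinite block sequences. For a block sequence $A=(x_n)$ let $\langle A\rangle=\mathrm{span}\{x_n\}$; for $Y\subseteq E$, $\langle Y\rangle=\mathrm{span}(Y)$. Block subspaces are subspaces $\langle A\rangle$ with $A\in E^{[\infty]}$ (identified with $A$). Two infinite-dimensional subspaces are almost disjoint if their intersection is finite-dimensional; $A,B\in E^{[\infty]}$ are almost disjoint iff $\langle A\rangle,\langle B\rangle$ are. $\mathcal{A}\subseteq E^{[\infty]}$ is almost disjoint if its members are pairwise almost disjoint, and mad if moreover no $B\in E^{[\infty]}$ is almost disjoint from every member of $\mathcal{A}$. A set $Y\subseteq E$ is big if $\langle C\rangle\subseteq Y$ for some $C\in E^{[\infty]}$. $\mathcal{I}^{++}(\mathcal{A})=\{Y\subseteq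 E:\{A\in\mathcal{A}: Y\cap\langle A\rangle\text{ is big}\}\text{ is infinite}\}$. *)

(* Defs.v *)
From HB Require Import structures.
From mathcomp Require Import all_boot all_order all_algebra.
From mathcomp Require Import all_classical.

Set Implicit Arguments.
Unset Strict Implicit.
Unset Printing Implicit Defensive.

Import Order.TTheory GRing.Theory.
Local Open Scope classical_set_scope.
Local Open Scope ring_scope.

Section BlockSubspaces.
Variables (F : fieldType) (E : lmodType F).

Definition lspan (Y : set E) : set E :=
  [set x | exists (n : nat) (c : 'I_n -> F) (y : 'I_n -> E),
     (forall i, Y (y i)) /\ x = \sum_(i < n) c i *: y i].

Definition hamel_basis (e : nat -> E) : Prop :=
  (forall (n : nat) (c : 'I_n -> F),
     \sum_(i < n) c i *: e i = 0 -> forall i, c i = 0)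
  /\ lspan (range e) = [set: E].

Definition finite_dimensional (W : set E) : Prop :=
  exists2 S : set E, finite_set S & W = lspan S.

Variable e : nat -> E.

(* The coefficients of x are read off any expansion of x as a finite linear
   combination of the e_i; when e is a Hamel basis all expansions agree, up to
   trailing zero coefficients. *)
Definition supp (x : E) : set nat :=
  [set n | exists (N : nat) (c : nat -> F),
     [/\ x = \sum_(i < N) c i *: e i, (n < N)%N & c n != 0]].

(* max (supp x) < min (supp y) *)
Definition block_lt (x y : E) : Prop :=
  exists m n : nat,
    [/\ supp x m /\ ubound (supp x) m,
        supp y n /\ lbound (supp y) n
      & (m < n)%N].

Definition block_seq : set (nat -> E) :=
  [set a | (forall n, a n != 0)
        /\ (forall m n : nat, (m < n)%N -> block_lt (a m) (a n))].

Definition block_span (a : nat -> E) : set E := lspan (range a).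

Definition almost_disjoint (a b : nat -> E) : Prop :=
  finite_dimensional (block_span a `&` block_span b).

Definition almost_disjoint_family (A : set (nat -> E)) : Prop :=
  forall a b, A a -> A b -> a <> b -> almost_disjoint a b.

Definition mad (A : set (nat -> E)) : Prop :=
  [/\ A `<=` block_seq,
      almost_disjoint_family A
    & ~ exists b, block_seq b /\ forall a, A a -> almost_disjoint a b].

Definition big (Y : set E) : Prop :=
  exists2 c, block_seq c & block_span c `<=` Y.

Definition Ipp (A : set (nat -> E)) : set (set E) :=
  [set Y | infinite_set [set a | A a /\ big (Y `&` block_span a)]].

Definition completely_separable (A : set (nat -> E)) : Prop :=
  forall Y : set E, Ipp A (lspan Y) ->
    exists2 a, A a & block_span a `<=` lspan Y.

End BlockSubspaces.

(* Main.v *)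
Require Import Defs.
From HB Require Import structures.
From mathcomp Require Import all_boot all_order all_algebra.
From mathcomp Require Import all_classical.
From mathcomp Require wochoice.
From mathcomp Require Import zify.

(** Let [lo x] be the least element of the support of [x].  Fix a splitting
    family of subsets of [nat] listed along a well-order of minimal length (the
    splitting number s), and label a block sequence [c] by the choices made by
    the set of all [lo (c n)] between the listed sets and their complements, up
    to the first listed set that splits it.  Two block subspaces with
    incompatible labels are almost disjoint.

    The family is built by recursion over all subsets [Y] of [E], of which there
    are continuum many.  If [Y] spans a block subspace almost disjoint from the
    previous members, or meets two of them in block subspaces, a new member is
    found inside the span of [Y].  A tree of successive splittings gives
    continuum many block sequences with pairwise incompatible labels inside the
    first intersection, hence a sequence [D] whose label is extended by no
    previous label; the previous members that can meet [D] then have proper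
    initial segments of its label as labels, so there are fewer than s of them.
    Fewer than s functions admit an eventually different function (s is at most
    the uniformity of the meager ideal), and this gives sums
    [D (phi n) + V (psi n)], with [V] in the second intersection, spanning a
    block subspace almost disjoint from all these members; the sums have the
    same [lo] as the terms of [D], so they inherit its label.

    At the end, a subspace meeting two members in block subspaces contains a
    member: either it met both at its own stage, or one of these intersections
    was then almost disjoint from all previous members. *)

Set Implicit Arguments.
Unset Strict Implicit.
Unset Printing Implicit Defensive.

Import GRing.Theory.
Local Open Scope classical_set_scope.

(** * Well-orders *)

Definition strict_wo (T : Type) (lt : T -> T -> Prop) : Prop :=
  [/\ forall P : set T, P !=set0 ->
        exists2 x, P x & forall y, P y -> ~ lt y x,
      forall x y z, lt x y -> lt y z -> lt x z
    & forall x y, lt x y \/ x = y \/ lt y x].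

Definition seg (T : Type) (lt : T -> T -> Prop) (x : T) : set T :=
  [set y | lt y x].

(** Totality comes from minima of two-element sets, antisymmetry from their uniqueness, and
    transitivity from minima of three-element sets. *)
Lemma strict_wo_ex (T : eqType) : exists lt : T -> T -> Prop, strict_wo lt.
Proof.
have [R woR] := wochoice.well_ordering_principle T.
have tot x y : R x y \/ R y x.
  have [|z [[+ zm] _]] := woR [pred u | (u == x) || (u == y)].
    by exists x; rewrite inE eqxx.
  by rewrite inE => /orP[] /eqP ez; [left|right]; rewrite -ez; apply: zm;
     rewrite inE eqxx ?orbT.
have anti x y : R x y -> R y x -> x = y.
  move=> xy yx.
  have Rxx u : R u u by case: (tot u u).
  have [|z [_ uz]] := woR [pred u | (u == x) || (u == y)].
    by exists x; rewrite inE eqxx.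
  have m1 : wochoice.minimum_of R [pred u | (u == x) || (u == y)] x.
    by split=> [|u]; rewrite !inE ?eqxx // => /orP[] /eqP ->.
  have m2 : wochoice.minimum_of R [pred u | (u == x) || (u == y)] y.
    by split=> [|u]; rewrite !inE ?eqxx ?orbT // => /orP[] /eqP ->.
  by rewrite -(uz _ m1) -(uz _ m2).
exists (fun x y => R x y /\ x <> y); split=> [P [p Pp]|x y z [xy nxy] [yz nyz]|x y].
- have [|z [[+ zm] _]] := woR [pred u | `[< P u >]].
    by exists p; apply/asboolP.
  move=> /asboolP Pz; exists z => // y Py [yz ne].
  by apply: ne; apply: anti => //; apply: zm; apply/asboolP.
- have [|w [[+ wm] _]] := woR [pred u | [|| u == x, u == y | u == z]].
    by exists x; rewrite inE eqxx.
  have wx : R w x by apply: wm; rewrite inE eqxx.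
  have wy : R w y by apply: wm; rewrite inE eqxx orbT.
  have wz : R w z by apply: wm; rewrite inE eqxx !orbT.
  rewrite inE => /or3P[] /eqP ew; subst w.
  + split=> // exz; subst z; apply: nxy; exact: anti.
  + by case: nxy; apply: anti.
  + by case: nyz; apply: anti.
- case: (pselect (x = y)) => [->|ne]; first by right; left.
  by case: (tot x y); [left|right; right]; split=> // /esym.
Qed.

Lemma strict_wo_wf (T : Type) (lt : T -> T -> Prop) :
  strict_wo lt -> well_founded lt.
Proof.
case=> mn _ _ x; apply: contrapT => nx.
have [|y ny ym] := mn [set x | ~ Acc lt x]; first by exists x.
by apply: ny; constructor=> z zy; apply: contrapT => nz; apply: (ym z).
Qed.

Lemma strict_wo_lex (T U : Type) (lt : T -> T -> Prop) (lt' : U -> U -> Prop)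
    (r : U -> T) : strict_wo lt -> strict_wo lt' ->
  strict_wo (fun p q => lt (r p) (r q) \/ r p = r q /\ lt' p q).
Proof.
move=> wo [mn' tr' tot']; have [mn tr tot] := wo; split.
- move=> P [p Pp].
  have [|m [q Pq qm] mm] := mn [set x | exists2 p, P p & r p = x].
    by exists (r p), p.
  have [|z [Pz zm] zmin] := mn' [set q | P q /\ r q = m]; first by exists q.
  exists z => // y Py [yz|[yz ltyz]].
    by apply: (mm (r y)); [exists y|rewrite -zm].
  by apply: (zmin y) => //; split=> //; rewrite yz.
- move=> p q s [pq|[pq lpq]] [qs|[qs lqs]].
  + by left; apply: tr qs.
  + by left; rewrite -qs.
  + by left; rewrite pq.
  + by right; split; [rewrite pq|apply: tr' lqs].
- move=> p q; case: (tot (r p) (r q)) => [h|[h|h]]; [by left; left| |by right; right; left].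
  by case: (tot' p q) => [|[]]; [left; right|right; left|right; right; right].
Qed.

(** * Comparison of cardinalities *)

Definition emb (T U : Type) (A : set T) (B : set U) : Prop :=
  exists2 f : T -> U, (forall x, A x -> B (f x)) &
    forall x y, A x -> A y -> f x = f y -> x = y.

Lemma emb_trans (T U V : Type) (A : set T) (B : set U) (C : set V) :
  emb A B -> emb B C -> emb A C.
Proof.
move=> [f fA fi] [g gB gi]; exists (g \o f) => [x Ax|x y Ax Ay /= e].
  exact/gB/fA.
by apply: fi => //; apply: gi => //; apply: fA.
Qed.

Lemma sub_emb (T : Type) (A B : set T) : A `<=` B -> emb A B.
Proof. by move=> AB; exists id. Qed.

Lemma emb_setX (T U : Type) (A : set T) (B : set U) :
  emb A B -> emb (A `*` A) (B `*` B).
Proof.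
move=> [f fA fi]; exists (fun p => (f p.1, f p.2)) => [p [p1 p2]|].
  by split; apply: fA.
by move=> [a b] [c d] [/= ? ?] [/= ? ?] [/fi -> // /fi -> //].
Qed.

Lemma emb_infinite (T U : Type) (A : set T) (B : set U) :
  emb A B -> infinite_set A -> infinite_set B.
Proof.
move=> [f fA fi] infA finB; apply: infA.
have finfA : finite_set (f @` A).
  by apply: sub_finite_set finB => _ [x Ax <-]; apply: fA.
rewrite -(eq_finite_set (@inj_card_eq _ _ A f _)) //.
by move=> x y /set_mem Ax /set_mem Ay; apply: fi.
Qed.

Lemma emb_preimage (T U : Type) (A : set T) (B : set U) (f : U -> T) :
  A `<=` f @` B -> A !=set0 -> emb A B.
Proof.
move=> Af [a Aa].
have [b0 _ _] := Af _ Aa.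
have /choice[g gP] x : exists y, A x -> B y /\ f y = x.
  by case: (pselect (A x)) => [/Af[y By <-]|nA]; [exists y|exists b0].
exists g => [x /gP[]//|x y /gP[_ gx] /gP[_ gy] e].
by rewrite -gx -gy e.
Qed.

(* Hessenberg's theorem.  When [seg x] embeds in no proper initial segment,
   list the pairs along the order by maximum and map each pair to a value not
   yet used: the pairs below a given one embed in a proper initial segment. *)
Lemma seg_square (K : eqType) (lt : K -> K -> Prop) : strict_wo lt ->
  forall x, infinite_set (seg lt x) ->
    emb (seg lt x `*` seg lt x) (seg lt x).
Proof.
move=> wo x; elim/(well_founded_ind (strict_wo_wf wo)): x => x IH infx.
have [mn tr tot] := wo.
case: (pselect (exists2 y, lt y x & emb (seg lt x) (seg lt y))) => [[y yx xy]|nemb].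
  apply: emb_trans (emb_setX xy) _.
  apply: emb_trans (IH y yx (emb_infinite xy infx)) _.
  by apply: sub_emb => z /= zy; apply: tr yx.
have [lt' wo'] := strict_wo_ex (K * K)%type.
pose mx (p : K * K) := if `[< lt p.1 p.2 >] then p.2 else p.1.
have mx1 p : lt p.1 (mx p) \/ p.1 = mx p.
  by rewrite /mx; case: asboolP => h; [left|right].
have mx2 p : lt p.2 (mx p) \/ p.2 = mx p.
  rewrite /mx; case: asboolP => h; [by right|].
  by case: (tot p.1 p.2) => [//|[->|]]; [right|left].
pose gl p q := lt (mx p) (mx q) \/ mx p = mx q /\ lt' p q.
have wog : strict_wo gl by apply: strict_wo_lex.
pose sq := seg lt x `*` seg lt x.
(* The default [x] lies outside [seg lt x]; [fP] shows that it is never returned on [sq]. *)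
pose step (p : K * K) (U : set K) : K :=
  match pselect (exists z, lt z x /\ ~ U z) with
  | left h => projT1 (cid h)
  | right _ => x
  end.
pose f := Fix (strict_wo_wf wog) (fun _ => K) (fun p rec =>
  step p [set z | exists q, exists h : gl q p, sq q /\ rec q h = z]).
have fE p : f p = step p [set z | exists q, exists h : gl q p, sq q /\ f q = z].
  rewrite /f Fix_eq // => q g g' gg'; congr (step q _).
  by apply/funext => z; apply/propext; split=> -[r [h [sr e]]]; exists r, h;
     split=> //; rewrite -e gg'.
have fP p : sq p -> lt (f p) x /\ (forall q, gl q p -> sq q -> f q <> f p).
  move=> [p1 p2]; rewrite fE /step; case: pselect => [h|nh].
    case: (cid h) => z [zx nz] /=; split=> // q qp sqq eq.
    by apply: nz; exists q, qp.
  (* If no value were left, [f] would map the pairs before [p] onto [seg lt x]. They all lie in the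
     square of [le], which is finite or embeds in [seg lt m]. *)
  exfalso.
  have mpx : lt (mx p) x by rewrite /mx; case: asboolP.
  have : emb (seg lt x) [set q | gl q p /\ sq q].
    apply: (emb_preimage (f := f)); last exact: infinite_setN0 infx.
    move=> z zx; apply: contrapT => nz; apply: nh; exists z; split=> // -[q [h [sqq e]]].
    by apply: nz; exists q.
  pose m := mx p; pose le := m |` seg lt m.
  have sub : [set q | gl q p /\ sq q] `<=` le `*` le.
    move=> q [qp _].
    have qm : lt (mx q) m \/ mx q = m by case: qp => [|[]]; [left|right].
    split; rewrite /le /=.
    - by case: (mx1 q) => [a|->]; case: qm => [b|<-]; [right; apply: tr b|right|right|left].
    - by case: (mx2 q) => [a|->]; case: qm => [b|<-]; [right; apply: tr b|right|right|left].
  move=> e1; have e2 := emb_trans e1 (sub_emb sub).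
  case: (pselect (finite_set (seg lt m))) => [fin|inf].
    apply: (emb_infinite e2 infx); apply: finite_setX; rewrite /le;
      by rewrite finite_setU; split=> //; apply: finite_set1.
  apply: nemb; exists m => //.
  have IHm := IH m mpx inf.
  apply: emb_trans e2 _; apply: (emb_trans _ IHm); apply: emb_setX.
  apply: (emb_trans _ IHm).
  have [a am] := infinite_setN0 inf.
  have [b [bm ba]] : exists b, lt b m /\ b <> a.
    apply: contrapT => nb; apply: inf; apply: sub_finite_set (finite_set1 a) => b bm /=.
    by apply: contrapT => ne; apply: nb; exists b.
  exists (fun y => if `[< y = m >] then (b, b) else (a, y)).
    move=> y; case: asboolP => [_ _|ne [/ne//|]]; by split.
  move=> y z _ _; case: asboolP => [->|_]; case: asboolP => [->|_] //.
  + by case=> /ba.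
  + by case=> /esym/ba.
  + by case.
exists f => [p /fP[]//|p q sp sq' e].
have [_ _ totg] := wog.
case: (totg p q) => [pq|[//|qp]].
  by have [_ /(_ _ pq sp)] := fP _ sq'; rewrite e.
by have [_ /(_ _ qp sq')] := fP _ sp; rewrite e.
Qed.

(** * Splitting and evasion on the natural numbers *)

Definition incr (j : nat -> nat) : Prop := forall n, j n < j n.+1.

Lemma incr_lt j m n : incr j -> m < n -> j m < j n.
Proof.
move=> ij; elim: n => // n IH; rewrite ltnS leq_eqVlt => /orP[/eqP->//|/IH mn].
exact: ltn_trans (ij n).
Qed.

Lemma incr_le j m n : incr j -> m <= n -> j m <= j n.
Proof.
by move=> ij; rewrite leq_eqVlt => /orP[/eqP->//|/(incr_lt ij)/ltnW].
Qed.

Lemma incr_inj j m n : incr j -> j m = j n -> m = n.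
Proof.
by move=> ij e; case: (ltngtP m n) => // /(incr_lt ij); rewrite e ltnn.
Qed.

Lemma incr_ge j n : incr j -> n <= j n.
Proof. by move=> ij; elim: n => // n IH; apply: leq_ltn_trans IH (ij n). Qed.

Lemma incr_comp i j : incr i -> incr j -> incr (i \o j).
Proof. by move=> ii ij n /=; apply: (incr_lt ii). Qed.

Lemma incr_enum (P : set nat) : (forall n, exists2 m, n <= m & P m) ->
  exists2 j, incr j & forall n, P (j n).
Proof.
move=> H.
have /choice[s sP] n : exists m, n <= m /\ P m by have [m] := H n; exists m.
exists (fun n => iter n (fun k => s k.+1) (s 0)) => [n|[|n]] /=.
- by case: (sP (iter n (fun k => s k.+1) (s 0)).+1).
- by case: (sP 0).
- by case: (sP (iter n (fun k => s k.+1) (s 0)).+1).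
Qed.

(* [ev_const x j i]: the sequence [j] is almost contained in the set [x] (for
   [i = true]) or in its complement (for [i = false]). *)
Definition ev_const (x : nat -> bool) (j : nat -> nat) (i : bool) : Prop :=
  exists N, forall n, N <= n -> x (j n) = i.

Lemma ev_const_sub x i j j' : incr j -> incr j' ->
  (exists N, forall n, N <= n -> exists p, j' n = j p) ->
  ev_const x j i -> ev_const x j' i.
Proof.
move=> ij ij' [M sub] [N xN]; exists (maxn M (j N)) => n; rewrite geq_max => /andP[Mn jNn].
have [p e] := sub n Mn; rewrite e; apply: xN; rewrite leqNgt; apply/negP => pN.
by have := incr_lt ij pN; rewrite -e ltnNge (leq_trans jNn) // incr_ge.
Qed.

Lemma ev_const_fun x j i i' : ev_const x j i -> ev_const x j i' -> i = i'.
Proof.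
move=> [N xN] [M xM].
by rewrite -(xN (maxn N M)) ?leq_maxl // xM // leq_maxr.
Qed.

Lemma not_ev_const x j i : ~ ev_const x j (~~ i) ->
  forall n, exists2 m, n <= m & x (j m) = i.
Proof.
move=> nc n; apply: contrapT => nm; apply: nc; exists n => m nm'.
case: (x (j m) =P i) => [xi|]; first by case: nm; exists m.
by case: (x _); case: (i).
Qed.

(* "[A] has fewer elements than the splitting number" *)
Definition unsplittable (T : Type) (A : set T) : Prop :=
  forall y : T -> nat -> bool, exists2 j, incr j &
    forall t, A t -> exists i, ev_const (y t) j i.

Lemma unsplittable_emb (T U : Type) (A : set T) (B : set U) :
  emb A B -> unsplittable B -> unsplittable A.
Proof.
move=> [f fA fi] uB y.
have /choice[g gP] u : exists x : nat -> bool, forall t, A t -> f t = u -> x = y t.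
  case: (pselect (exists2 t, A t & f t = u)) => [[t At ft]|nt].
    by exists (y t) => t' At' ft'; congr y; apply: fi => //; rewrite ft ft'.
  by exists xpredT => t At ft; case: nt; exists t.
have [j ij jP] := uB g; exists j => // t At.
by have [i] := jP _ (fA _ At); rewrite (gP _ t) //; exists i.
Qed.

(** In cardinal terms, [A] is smaller than the bounding number. *)
Definition bounded_families (T : Type) (A : set T) : Prop :=
  forall h : T -> nat -> nat, exists g : nat -> nat,
    forall t, A t -> exists N, forall n, N <= n -> h t n <= g n.

Lemma finite_bounded_families (T : eqType) (A : set T) :
  finite_set A -> bounded_families A.
Proof.
move=> /finite_seqP[s As] h; exists (fun n => \max_(t <- s) h t n) => t.
by rewrite As => /= ts; exists 0 => n _; rewrite (big_rem t) //= leq_maxl.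
Qed.

(** Take [m] with [G (G m) <= h m] between the orbit terms [t k] and [t k.+1]. If
    [t k.+1 < G (t k)], then [t k.+1 <= G m], and monotonicity gives the inequality one step
    later. *)
Lemma unbounded_orbit (h G : nat -> nat) :
  (forall m, m < h m) -> {homo h : m n / m <= n} -> {homo G : m n / m <= n} ->
  (forall n, exists2 m, n <= m & G (G m) <= h m) ->
  forall n, exists2 k, n <= k & G (iter k h 0) <= iter k.+1 h 0.
Proof.
move=> hgt hmono Gmono inf n.
pose t k := iter k h 0.
have tS k : t k.+1 = h (t k) by [].
have it : incr t by move=> k; rewrite tS.
have [m nm Gm] := inf (t n.+1).
have [k [nk km mk]] : exists k, [/\ n <= k, t k <= m & m < t k.+1].
  have ex : exists k, m < t k by exists m.+1; apply: incr_ge.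
  case: (ex_minnP ex) => -[|k] mk kmin; first by [].
  exists k; split=> //.
    rewrite leqNgt; apply/negP => kn; have := leq_trans nm (ltnW mk).
    by apply/negP; rewrite -ltnNge; apply: incr_lt => //; apply: leq_trans kn _.
  by rewrite leqNgt; apply/negP => /kmin; rewrite ltnn.
case: (leqP (G (t k)) (t k.+1)) => [le|lt]; first by exists k.
exists k.+1; first exact: leqW.
apply: leq_trans (_ : h m <= _); last exact/hmono/ltnW.
apply: leq_trans Gm; apply: (Gmono).
by apply: leq_trans (ltnW lt) _; apply: (Gmono).
Qed.

(* The sets [y] code the functions [f t] along the orbits of an unbounded
   family; an increasing [j] unsplittable by all of them is cut into its even and
   odd terms, and no [f t] can guess this cut on an interval containing two
   consecutive terms of [j]. *)
Lemma partial_evader (T : Type) (A : set T) :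
  unsplittable (A `*` A) -> ~ bounded_families A ->
  forall f : T -> nat -> nat, exists (X : set nat) (g : nat -> nat),
    (forall n, exists2 m, n <= m & X m) /\
    forall t, A t -> exists N, forall n, N <= n -> X n -> f t n <> g n.
Proof.
move=> uAA /existsNP[h hunb] f.
(* A monotone majorant of [h b] with [m < H b m]: its orbit [t b] cuts the natural numbers into
   intervals. *)
pose H b m := \sum_(i < m.+1) h b i + m.+1.
have Hgt b m : m < H b m by rewrite /H; lia.
have Hmono b : {homo H b : m n / m <= n}.
  move=> m n mn; rewrite /H leq_add //.
  by rewrite -!(big_mkord xpredT (h b)) [leqRHS](big_cat_nat _ (n := m.+1)) //= leq_addr.
have Hh b m : h b m <= H b m by rewrite /H big_ord_recr /=; lia.
pose t b n := iter n (H b) 0.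
have it b : incr (t b) by move=> n /=.
pose dec v : seq nat := odflt [::] (unpickle v).
pose y (p : T * T) (k : nat) : bool :=
  `[< exists n, t p.2 n <= k < t p.2 n.+1 /\ k \in dec (f p.1 n) >].
have [j ij jP] := uAA y.
(* If [G m <= t b n.+1] with [m = t b n], the terms of [j] at [m.*2] and [m.*2.+1] both lie in the
   [n]-th interval of [t b]. *)
pose G m := (j m.*2.+1).+1.
have Gmono : {homo G : m n / m <= n}.
  by move=> m n mn; rewrite /G ltnS; apply: incr_le => //; lia.
(* Otherwise [G \o G] would dominate the family [h]. *)
have [b [Ab bP]] : exists b, A b /\ forall n, exists2 m, n <= m & G (G m) <= H b m.
  apply: contrapT => nb; apply: hunb; exists (G \o G) => b Ab.
  apply: contrapT => nN; apply: nb; exists b; split=> // n.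
  apply: contrapT => nm; apply: nN; exists n => m nm'.
  rewrite leqNgt; apply/negP => lt; apply: nm; exists m => //.
  exact: leq_trans (ltnW lt) (Hh b m).
pose g n := pickle [seq k <- iota 0 (t b n.+1) | `[< exists i, k = j i.*2 >]].
exists [set n | G (t b n) <= t b n.+1], g; split.
  exact: unbounded_orbit (Hgt b) (Hmono b) Gmono bP.
move=> a Aa; have [i [N yN]] := jP (a, b) (conj Aa Ab).
exists N => n Nn /= Xn fg.
have Nt : N <= (t b n).*2 by have := incr_ge n (it b); lia.
have e1 := yN _ Nt; have e2 := yN _ (leqW Nt).
have j1 : t b n <= j (t b n).*2.
  by have := incr_ge (t b n).*2 ij; lia.
have j2 := ij (t b n).*2.
have j3 : j (t b n).*2.+1 < t b n.+1 := Xn.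
have decE : dec (f a n) = [seq k <- iota 0 (t b n.+1) | `[< exists i, k = j i.*2 >]].
  by rewrite fg /dec /g pickleK.
have y1 : y (a, b) (j (t b n).*2).
  apply/asboolP; exists n; split; first by rewrite j1; apply: ltn_trans j2 j3.
  rewrite decE mem_filter mem_iota add0n leq0n (ltn_trans j2 j3) !andbT.
  by apply/asboolP; exists (t b n).
have : y (a, b) (j (t b n).*2.+1) by rewrite e2 -e1.
move=> /asboolP[n' [/andP[l1 l2]]].
have -> : n' = n.
  case: (ltngtP n' n) => // lt; exfalso.
    have := leq_trans l2 (incr_le (it b) lt).
    by rewrite ltnNge (leq_trans j1 (ltnW j2)).
  by have := leq_trans j3 (incr_le (it b) lt); rewrite ltnNge l1.
rewrite decE mem_filter => /andP[/asboolP[k /(incr_inj ij)]]; lia.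
Qed.

(* A total function is turned into a guess of [n.+1] values of a partial one at
   each [n]; picking each time a value at a new argument makes infinitely many
   correct guesses collect infinitely many correct values. *)
Lemma total_evader (T : Type) (A : set T) :
  (forall f : T -> nat -> nat, exists (X : set nat) (g : nat -> nat),
    (forall n, exists2 m, n <= m & X m) /\
    forall t, A t -> exists N, forall n, N <= n -> X n -> f t n <> g n) ->
  forall f : T -> nat -> nat, exists g : nat -> nat,
    forall t, A t -> exists N, forall n, N <= n -> f t n <> g n.
Proof.
move=> part f.
pose L t n : seq (nat * nat) := odflt [::] (unpickle (f t n)).
pose pk (u : seq nat) (l : seq (nat * nat)) := ohead [seq p <- l | p.1 \notin u].
pose used t := fix used n : seq nat := if n is m.+1 then
  (if pk (used m) (L t m) is Some p then p.1 :: used m else used m) else [::].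
have pkP u l p : pk u l = Some p -> p.1 \notin u /\ p \in l.
  rewrite /pk; case E: [seq _ <- _ | _] => [//|q s] [<-].
  have : q \in q :: s by rewrite mem_head.
  by rewrite -E mem_filter => /andP.
have used_size t n : size (used t n) <= n.
  by elim: n => //= n IH; case: (pk _ _) => [p|] //=; apply: leqW.
have used_mono t m n : m <= n -> {subset used t m <= used t n}.
  move=> mn k km; elim: n mn => [|n IH]; first by rewrite leqn0 => /eqP <-.
  rewrite leq_eqVlt => /orP[/eqP <-//|/IH kn] /=.
  by case: (pk _ _) => [p|] //; rewrite inE kn orbT.
have pk_used t n p : pk (used t n) (L t n) = Some p -> p.1 \in used t n.+1.
  by move=> /= ->; rewrite mem_head.
have key_inj t m n p q : pk (used t m) (L t m) = Some p ->
    pk (used t n) (L t n) = Some q -> p.1 = q.1 -> m = n.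
  move=> pm qn e; case: (ltngtP m n) => // lt; exfalso.
    have [/negP nq _] := pkP _ _ _ qn; apply: nq; rewrite -e.
    exact: used_mono lt _ (pk_used _ _ _ pm).
  have [/negP nq _] := pkP _ _ _ pm; apply: nq; rewrite e.
  exact: used_mono lt _ (pk_used _ _ _ qn).
(* No argument is selected twice, so the selected pairs form the graph of a partial function,
   completed by zeros. *)
have /choice[f' f'P] t : exists v : nat -> nat, forall n p,
    pk (used t n) (L t n) = Some p -> v p.1 = p.2.
  suff /choice[v vP] k : exists v, forall n p,
      pk (used t n) (L t n) = Some p -> p.1 = k -> v = p.2.
    by exists v => n p h; apply: vP h _.
  case: (pselect (exists n p, pk (used t n) (L t n) = Some p /\ p.1 = k)).
    move=> [n [p [pn pk1]]]; exists p.2 => m q qm qk.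
    have e : m = n by apply: key_inj qm pn _; rewrite qk.
    by move: qm; rewrite e pn => -[->].
  by move=> nk; exists 0 => n p pn pk1; case: nk; exists n, p.
have [X [g [Xinf gP]]] := part f'.
have [x ix xX] := incr_enum Xinf.
exists (fun n => pickle [seq (x i, g (x i)) | i <- iota 0 n.+1]) => t At.
have [N gN] := gP t At.
(* A correct guess lists [n.+1] distinct arguments, of which at most [n] are used. So a fresh pair
   is selected, and [f'] agrees with [g] on it, which forces its argument below [N]. *)
have bad n : f t n = pickle [seq (x i, g (x i)) | i <- iota 0 n.+1] ->
    exists2 p, pk (used t n) (L t n) = Some p & p.1 < N.
  move=> fn.
  have LE : L t n = [seq (x i, g (x i)) | i <- iota 0 n.+1] by rewrite /L fn pickleK.
  case E: (pk (used t n) (L t n)) => [p|]; last first.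
    exfalso; move: E; rewrite /pk; case E: [seq _ <- _ | _] => [|//] _.
    have sub : {subset [seq x i | i <- iota 0 n.+1] <= used t n}.
      move=> _ /mapP[i iin ->]; apply/negPn/negP => nin.
      have : (x i, g (x i)) \in [seq p <- L t n | p.1 \notin used t n].
        by rewrite mem_filter /= nin LE; apply: map_f.
      by rewrite E.
    have un : uniq [seq x i | i <- iota 0 n.+1].
      by rewrite map_inj_uniq ?iota_uniq // => a b; apply: incr_inj.
    by have := uniq_leq_size un sub; rewrite size_map size_iota ltnNge used_size.
  exists p => //; have e := f'P _ _ _ E.
  have [_] := pkP _ _ _ E; rewrite LE => /mapP[i _ pE].
  rewrite ltnNge; apply/negP => Nle.
  by apply: (gN _ Nle); [rewrite pE; apply: xX|rewrite e pE].
apply: contrapT => nN.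
have inf n : exists2 m, n <= m &
    f t m = pickle [seq (x i, g (x i)) | i <- iota 0 m.+1].
  apply: contrapT => nm; apply: nN; exists n => m nm' e; apply: nm; by exists m.
have [jj ijj jjP] := incr_enum inf.
have /choice[k kP] n : exists p, pk (used t (jj n)) (L t (jj n)) = Some p /\ p.1 < N.
  by have [p] := bad _ (jjP n); exists p.
have kinj : injective (fun n => (k n).1).
  move=> m n e; apply: (incr_inj ijj).
  by have [km _] := kP m; have [kn _] := kP n; apply: key_inj km kn e.
have [m] := injective_gtn kinj N.
by have [_ kN] := kP m; rewrite ltnNge (ltnW kN).
Qed.

(** If families over [A] are bounded, the successor of a dominating function works. Otherwise [A] is
    infinite, so its square embeds in [A] and is again unsplittable, as the partial evader
    requires. *)
Lemma evader (T : eqType) (A : set T) :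
  unsplittable A -> (infinite_set A -> emb (A `*` A) A) ->
  forall f : T -> nat -> nat, exists g : nat -> nat,
    forall t, A t -> exists N, forall n, N <= n -> f t n <> g n.
Proof.
move=> uA sqA f; case: (pselect (bounded_families A)) => [bd|nbd].
  have [g gP] := bd f; exists (fun n => (g n).+1) => t /gP[N fN].
  by exists N => n /fN le e; move: le; rewrite e ltnn.
apply: total_evader; apply: partial_evader => //.
by apply: unsplittable_emb uA; apply: sqA => /finite_bounded_families.
Qed.

(** Diagonal coding: [G q] codes [K q] numbers, and [f t] at the code of [(q, i)] reads the [i]-th
    number coded by the [i]-th element of [l t q]. If [G q] is that element, then [f t] meets [g]
    there, which happens at finitely many codes only. *)
Lemma slalom_evader (T : eqType) (A : set T) (Q : countType) (K : Q -> nat) :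
  unsplittable A -> (infinite_set A -> emb (A `*` A) A) -> forall l : T -> Q -> seq nat,
  (forall t q, size (l t q) <= K q) ->
  exists G : Q -> nat, forall t, A t ->
    exists bad : seq Q, forall q, G q \in l t q -> q \in bad.
Proof.
move=> uA sqA l lK.
pose f t n := if unpickle n is Some (q, i) then
  nth 0 (odflt [::] (unpickle (nth 0 (l t q) i)) : seq nat) i else 0.
have [g gP] := evader uA sqA f.
exists (fun q => pickle [seq g (pickle (q, i)) | i <- iota 0 (K q)]) => t At.
have [N gN] := gP t At.
exists (pmap (fun n => omap fst (unpickle n : option (Q * nat))) (iota 0 N)) => q.
move=> Gl; set G := pickle _ in Gl.
pose i := index G (l t q).
have il : i < size (l t q) by rewrite index_mem.
have iK : i < K q := leq_trans il (lK t q).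
rewrite mem_pmap; apply/mapP; exists (pickle (q, i)); last by rewrite pickleK.
rewrite mem_iota /= add0n ltnNge; apply/negP => /gN; apply.
rewrite /f pickleK nth_index // pickleK /=.
by rewrite (nth_map 0) ?size_iota // nth_iota.
Qed.

(** * Labels *)

(* [S] enumerates, along an order of minimal length, a splitting family of
   subsets of [nat]. *)
Definition splitting (K : Type) (lt : K -> K -> Prop) (S : set K)
    (x : K -> nat -> bool) : Prop :=
  [/\ strict_wo lt,
      forall a b, lt a b -> S b -> S a,
      forall j, incr j -> exists2 k, S k & forall i, ~ ev_const (x k) j i
    & forall k, S k -> unsplittable (seg lt k)].

(** A well-order of [nat -> bool] is cut at the least index whose segment can index a splitting
    family; if there is none, all subsets of [nat] are used. *)
Lemma splitting_ex :
  exists (lt : (nat -> bool) -> (nat -> bool) -> Prop) S x, splitting lt S x.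
Proof.
have [lt wo] := strict_wo_ex (nat -> bool).
exists lt; have [mn tr _] := wo.
case: (pselect (exists k, ~ unsplittable (seg lt k))) => [ex|nex].
  have [k /existsNP[y yP] kmin] := mn [set k | ~ unsplittable (seg lt k)] ex.
  exists (seg lt k), y; split=> //.
  - by move=> a b ab bk; apply: tr bk.
  - move=> j ij; apply: contrapT => nk; apply: yP; exists j => // t tk.
    apply: contrapT => ni; apply: nk; exists t => // i ji.
    by apply: ni; exists i.
  - by move=> b bk; apply: contrapT => /kmin.
exists setT, id; split=> //.
(* The set of even-indexed terms of [j] splits [j]. *)
- move=> j ij; exists (fun n => `[< exists i, n = j i.*2 >]) => // i [N iN].
  have := iN N.*2; have := iN N.*2.+1 => /=.
  case: asboolP => [[k /(incr_inj ij)]|_ e1]; first lia.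
  by case: asboolP => [_ e2|[]]; [move: e1; rewrite -e2; lia|exists N].
- by move=> k _; apply: contrapT => nu; apply: nex; exists k.
Qed.

Section Labels.
Variables (K : eqType) (lt : K -> K -> Prop) (S : set K) (x : K -> nat -> bool).
Hypothesis spl : splitting lt S x.

Definition first_split (j : nat -> nat) (k : K) : Prop :=
  [/\ S k, forall i, ~ ev_const (x k) j i
    & forall h, lt h k -> exists i, ev_const (x h) j i].

(* The label of [j] is the sequence of values decided by [j] up to its first
   splitting index; [extends a j] says that the label of [a] extends it. *)
Definition extends (a j : nat -> nat) : Prop :=
  forall k h, first_split j k -> lt h k ->
    exists2 i, ev_const (x h) j i & ev_const (x h) a i.

Lemma first_split_ex j : incr j -> exists k, first_split j k.
Proof.
have [[mn _ _] dS sp _] := spl => ij.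
have [|k [Sk nk] kmin] := mn [set k | S k /\ forall i, ~ ev_const (x k) j i].
  by have [k Sk nk] := sp j ij; exists k.
exists k; split=> // h hk; apply: contrapT => nh; apply: (kmin h) => //.
by split; [apply: dS hk Sk|move=> i hi; apply: nh; exists i].
Qed.

Lemma first_split_lt j k k' : first_split j k -> S k' ->
  (forall h, lt h k' \/ h = k' -> exists i, ev_const (x h) j i) -> lt k' k.
Proof.
have [[_ _ tot] _ _ _] := spl => -[Sk nk _] Sk' dk'.
case: (tot k' k) => [//|kk'].
have [|i ki] := dk' k; first by case: kk' => [->|]; [right|left].
by case: (nk i).
Qed.

(** Otherwise each subsequence has its label extended by a member of [P]. In a binary tree of
    subsequences, each node divided by its first splitting index, every branch [f] then gets a
    member recording all choices of [f], so the continuum embeds in [P]. *)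
Lemma unextended_subseq (U : Type) (P : set U) (lab : U -> nat -> nat) j0 :
  incr j0 -> ~ emb [set: nat -> bool] P ->
  exists2 phi, incr phi & forall a, P a -> ~ extends (lab a) (j0 \o phi).
Proof.
move=> ij0 nemb; apply: contrapT => nphi.
have bad phi : incr phi -> exists2 a, P a & extends (lab a) (j0 \o phi).
  move=> iphi; apply: contrapT => na; apply: nphi; exists phi => // a Pa ea.
  by apply: na; exists a.
have [k0 _] := first_split_ex ij0.
have /choice[ka kaP] phi : exists k, incr phi -> first_split (j0 \o phi) k.
  case: (pselect (incr phi)) => [iphi|]; last by exists k0.
  by have [k] := first_split_ex (incr_comp ij0 iphi); exists k.
have /choice[ps psP] (p : bool * (nat -> nat)) : exists r, incr p.2 ->
    incr r /\ forall n, x (ka p.2) (j0 (p.2 (r n))) = p.1.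
  case: (pselect (incr p.2)) => [ip|]; last by exists id.
  have [_ nk _] := kaP _ ip.
  by have [r] := incr_enum (not_ev_const (nk (~~ p.1))); exists r.
pose node (f : nat -> bool) := fix node n :=
  if n is m.+1 then node m \o ps (f m, node m) else id.
have inode f n : incr (node f n).
  elim: n => [|n IH] //; apply: incr_comp => //.
  by have [] := psP (f n, node f n) IH.
have node_eq f f' n : (forall m, m < n -> f m = f' m) -> node f n = node f' n.
  elim: n => //= n IH ff'; rewrite IH ?ff' // => m mn; exact/ff'/ltnW.
have node_sub f m n : m <= n -> forall p, exists q, node f n p = node f m q.
  move=> mn p; elim: n mn p => [|n IH]; first by rewrite leqn0 => /eqP -> p; exists p.
  rewrite leq_eqVlt => /orP[/eqP -> p|/IH sub p]; first by exists p.
  exact: sub.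
(* From its [n]-th term on, the diagonal runs inside [node f n], so it decides every index split
   along the branch. *)
pose ph f n := node f n n.
have iph f : incr (ph f).
  move=> n; rewrite /ph /=.
  have [ir _] := psP (f n, node f n) (inode f n).
  by apply: (incr_lt (inode f n)); apply: incr_ge.
have ph_ev f m y i : ev_const y (j0 \o node f m) i -> ev_const y (j0 \o ph f) i.
  apply: ev_const_sub; [exact: incr_comp|exact: incr_comp|].
  exists m => n mn; have [q e] := node_sub f m n mn n.
  by exists q; rewrite /= /ph e.
have ph_ka f n : ev_const (x (ka (node f n))) (j0 \o ph f) (f n).
  apply: (ph_ev f n.+1); exists 0 => p _ /=.
  by have [_ ->] := psP (f n, node f n) (inode f n).
have ph_first f n k : first_split (j0 \o ph f) k -> lt (ka (node f n)) k.
  move=> fk; apply: first_split_lt fk _ _; first by case: (kaP _ (inode f n)).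
  move=> h [hk|->]; last by exists (f n).
  have [_ _ /(_ h hk)[i hi]] := kaP _ (inode f n).
  by exists i; apply: ph_ev hi.
have /choice[a aP] f : exists a, P a /\ extends (lab a) (j0 \o ph f).
  by have [a] := bad _ (iph f); exists a.
have a_col f n : ev_const (x (ka (node f n))) (lab (a f)) (f n).
  have [k fk] := first_split_ex (incr_comp ij0 (iph f)).
  have [_ /(_ k _ fk (ph_first f n k fk))[i i1 i2]] := aP f.
  by rewrite (ev_const_fun (ph_ka f n) i1).
apply: nemb; exists a => [f _|f f' _ _ e]; first by case: (aP f).
(* At a first difference the branches would share a node, hence its splitting index, which one
   sequence cannot decide both ways. *)
apply/funext => n; elim/ltn_ind: n => n IH.
have := a_col f n; rewrite (node_eq f f' n IH) e.
by move/ev_const_fun; apply; apply: a_col.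
Qed.

(* Members of the family that are compatible with [j] without extending its
   label have proper initial segments of it as labels, hence are determined by
   their first splitting index. *)
Lemma compatible_first_split j a k c : incr j -> incr a -> incr c ->
  (forall n, exists p, c n = j p) -> (forall n, exists p, c n = a p) ->
  first_split j k -> ~ extends a j ->
  exists2 h, lt h k & first_split a h /\
    forall h', lt h' h -> exists2 i, ev_const (x h') j i & ev_const (x h') a i.
Proof.
have [wo dS _ _] := spl; have [_ tr tot] := wo.
move=> ij ia ic cj ca fk next.
have agree h i i' : ev_const (x h) j i -> ev_const (x h) a i' -> i = i'.
  move=> ji ai; apply: (@ev_const_fun (x h) c).
    by apply: ev_const_sub ji => //; exists 0.
  by apply: ev_const_sub ai => //; exists 0.
have [h fh] := first_split_ex ia; have [Sk _ dk] := fk; have [Sh _ dh] := fh.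
have hk : lt h k.
  apply: contrapT => nhk; apply: next => k' h' fk' h'k'.
  have e : k' = k.
    have [Sk' nk' dk'] := fk'; have [_ nk _] := fk.
    case: (tot k' k) => [/dk[i /nk']//|[//|/dk'[i /nk]//]].
  rewrite e in h'k' => {k' e fk'}.
  have [i ji] := dk _ h'k'.
  have [|i' ai'] := dh h'.
    by case: (tot h k) => [//|[->//|kh]]; apply: tr kh.
  by exists i => //; rewrite (agree _ _ _ ji ai').
exists h => //; split=> // h' h'h.
have [i ji] := dk _ (tr _ _ _ h'h hk); have [i' ai'] := dh _ h'h.
by exists i => //; rewrite (agree _ _ _ ji ai').
Qed.

Lemma first_split_uniq j k k' : first_split j k -> first_split j k' -> k = k'.
Proof.
have [[_ _ tot] _ _ _] := spl => -[_ nk dk] [_ nk' dk'].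
by case: (tot k k') => [/dk'[i /nk]|[|/dk[i /nk']]].
Qed.

(** Passing to a subsequence can only lengthen the label. *)
Lemma extends_sub a j j' : incr j -> incr j' ->
  (forall n, exists p, j' n = j p) -> extends a j' -> extends a j.
Proof.
move=> ij ij' sub ea k h fk hk.
have mono y i : ev_const y j i -> ev_const y j' i.
  by apply: ev_const_sub => //; exists 0.
have [k' fk'] := first_split_ex ij'.
have [_ dS _ _] := spl; have [Sk _ dk] := fk; have [[_ tr _] _ _ _] := spl.
have hk' : lt h k'.
  apply: (first_split_lt fk'); first exact: dS hk Sk.
  move=> h' h'h; have [|i /mono] := dk h'; last by exists i.
  by case: h'h => [h'h|->] //; apply: tr hk.
have [i i1 i2] := ea k' h fk' hk'; have [i' ji'] := dk h hk.
by exists i => //; rewrite (ev_const_fun i1 (mono _ _ ji')).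
Qed.

End Labels.

(** * Coordinates and block sequences *)

Local Open Scope ring_scope.

Section Subspaces.
Variables (F : fieldType) (E : lmodType F).

Definition subspace (W : set E) : Prop :=
  W 0 /\ forall (a : F) x y, W x -> W y -> W (a *: x + y).

Lemma subspaceZ W a x : subspace W -> W x -> W (a *: x).
Proof. by move=> [W0 WZ] Wx; rewrite -[_ *: _]addr0; apply: WZ. Qed.

Lemma subspaceD W x y : subspace W -> W x -> W y -> W (x + y).
Proof. by move=> [_ WZ] Wx Wy; rewrite -[x]scale1r; apply: WZ. Qed.

Lemma subspaceB W x y : subspace W -> W x -> W y -> W (x - y).
Proof. by move=> [_ WZ] Wx Wy; rewrite addrC -scaleN1r; apply: WZ. Qed.

Lemma subspace_sum W (I : Type) (r : seq I) (P : pred I) (f : I -> E) :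
  subspace W -> (forall i, P i -> W (f i)) -> W (\sum_(i <- r | P i) f i).
Proof.
move=> sW fW; apply: (big_ind W) => //; first by case: sW.
by move=> x y; apply: subspaceD.
Qed.

Lemma subspaceI W W' : subspace W -> subspace W' -> subspace (W `&` W').
Proof.
move=> [W0 WZ] [W'0 W'Z]; split=> // a x y [Wx W'x] [Wy W'y].
by split; [apply: WZ|apply: W'Z].
Qed.

Lemma lspan_subspace (Y : set E) : subspace (lspan Y).
Proof.
split; first by exists 0%N, (fun _ => 0), (fun _ => 0); split=> [[]|] //; rewrite big_ord0.
move=> a x y [n [c [u [uY ->]]]] [m [d [v [vY ->]]]].
exists (n + m)%N.
exists (fun i => match fintype.split i with inl k => a * c k | inr k => d k end).
exists (fun i => match fintype.split i with inl k => u k | inr k => v k end); split.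
  by move=> i; case: (fintype.split i).
rewrite big_split_ord /= scaler_sumr; congr (_ + _); apply: eq_bigr => i _.
  by rewrite (unsplitK (inl i)) scalerA.
by rewrite (unsplitK (inr i)).
Qed.

Lemma sub_lspan (Y : set E) : Y `<=` lspan Y.
Proof.
move=> y Yy; exists 1%N, (fun _ => 1), (fun _ => y).
by rewrite big_ord1 scale1r.
Qed.

Lemma lspan_min (Y W : set E) : subspace W -> Y `<=` W -> lspan Y `<=` W.
Proof.
move=> sW YW _ [n [c [u [uY ->]]]]; apply: subspace_sum => // i _.
by apply: subspaceZ => //; apply/YW/uY.
Qed.

Lemma block_span_mem (a : nat -> E) n : block_span a (a n).
Proof. by apply: sub_lspan; exists n. Qed.

Lemma block_span_min (a : nat -> E) (W : set E) : subspace W ->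
  (forall n, W (a n)) -> block_span a `<=` W.
Proof. by move=> sW aW; apply: lspan_min => // _ [n _ <-]. Qed.

Lemma sum_widen0 (a : nat -> E) n m (c : nat -> F) : (n <= m)%N ->
  (forall i, (n <= i)%N -> c i = 0) ->
  \sum_(i < n) c i *: a i = \sum_(i < m) c i *: a i.
Proof.
move=> nm c0; rewrite (big_ord_widen m (fun i => c i *: a i) nm) big_mkcond.
by apply: eq_bigr => k _; case: ltnP => // /c0 ->; rewrite scale0r.
Qed.

Lemma block_spanP (a : nat -> E) x : block_span a x ->
  exists n (c : nat -> F), x = \sum_(i < n) c i *: a i.
Proof.
pose W : set E := [set x | exists n (c : nat -> F), x = \sum_(i < n) c i *: a i].
have ext n m (c : nat -> F) : (n <= m)%N ->
    \sum_(i < n) c i *: a i = \sum_(i < m) (if (i < n)%N then c i else 0) *: a i.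
  move=> nm; rewrite (big_ord_widen m (fun i => c i *: a i) nm) big_mkcond.
  by apply: eq_bigr => i _; case: ifP; rewrite ?scale0r.
apply: (@block_span_min a W) => [|n]; last first.
  exists n.+1, (fun i => (i == n)%:R); rewrite big_ord_recr /= eqxx scale1r.
  by rewrite big1 ?add0r // => i _; rewrite ltn_eqF ?scale0r.
split; first by exists 0%N, (fun _ => 0); rewrite big_ord0.
move=> l _ _ [n [c ->]] [m [d ->]].
exists (maxn n m), (fun i => l * (if (i < n)%N then c i else 0) +
  (if (i < m)%N then d i else 0)).
rewrite (ext n (maxn n m)) ?leq_maxl // (ext m (maxn n m)) ?leq_maxr //.
rewrite scaler_sumr -big_split; apply: eq_bigr => i _.
by rewrite scalerA scalerDl.
Qed.

Lemma block_span_top (a : nat -> E) x : block_span a x -> x != 0 ->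
  exists n (c : nat -> F), c n != 0 /\ x = \sum_(i < n.+1) c i *: a i.
Proof.
move=> /block_spanP[n [c ->]]; elim: n => [|n IH]; first by rewrite big_ord0 eqxx.
case: (eqVneq (c n) 0) => [cn|cn _]; last by exists n, c.
by rewrite big_ord_recr /= cn scale0r addr0.
Qed.

Lemma block_span_sub (a b : nat -> E) : (forall n, block_span b (a n)) ->
  block_span a `<=` block_span b.
Proof. by apply: block_span_min; apply: lspan_subspace. Qed.

End Subspaces.

Section Coordinates.
Variables (F : fieldType) (E : lmodType F) (e : nat -> E).
Hypothesis he : hamel_basis e.

Lemma coord_ex (x : E) : exists c : nat -> F, exists N : nat,
  (forall i, (N <= i)%N -> c i = 0) /\ x = \sum_(i < N) c i *: e i.
Proof.
have : block_span e x by rewrite /block_span he.2.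
move=> /block_spanP[n [c ->]]; exists (fun i => if (i < n)%N then c i else 0), n.
split=> [i|]; first by rewrite ltnNge => ->.
by apply: eq_bigr => i _; rewrite ltn_ord.
Qed.

Definition cf (x : E) : nat -> F := projT1 (cid (coord_ex x)).

Lemma cfP x : exists N : nat,
  (forall i, (N <= i)%N -> cf x i = 0) /\ x = \sum_(i < N) cf x i *: e i.
Proof. by rewrite /cf; case: (cid _). Qed.

Lemma cf_uniq x (c : nat -> F) N : (forall i, (N <= i)%N -> c i = 0) ->
  x = \sum_(i < N) c i *: e i -> cf x =1 c.
Proof.
move=> c0 xc i; have [M [d0 xd]] := cfP x.
pose R := maxn i.+1 (maxn N M).
have iR : (i < R)%N by rewrite /R leq_maxl.
rewrite (sum_widen0 e (m := R) _ c0) // in xc; last by rewrite /R; lia.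
rewrite (sum_widen0 e (m := R) _ d0) // in xd; last by rewrite /R; lia.
apply/eqP; rewrite -subr_eq0; apply/eqP.
apply: (he.1 R (fun k => cf x k - c k) _ (Ordinal iR)).
under eq_bigr do rewrite scalerBl.
by rewrite sumrB -xc -xd subrr.
Qed.

Lemma cf_lin a x y i : cf (a *: x + y) i = a * cf x i + cf y i.
Proof.
have [N [x0 xE]] := cfP x; have [M [y0 yE]] := cfP y.
pose R := maxn N M.
apply: (@cf_uniq _ (fun i => a * cf x i + cf y i) R) => [k kR|].
  by rewrite x0 ?y0 ?mulr0 ?addr0 //; rewrite /R in kR; lia.
rewrite {1}xE {1}yE (sum_widen0 e (m := R) _ x0) ?leq_maxl // (sum_widen0 e (m := R) _ y0) ?leq_maxr //.
rewrite scaler_sumr -big_split; apply: eq_bigr => k _.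
by rewrite scalerA scalerDl.
Qed.

Lemma cf0 i : cf 0 i = 0.
Proof. by apply: (@cf_uniq _ (fun _ => 0) 0%N); rewrite ?big_ord0. Qed.

Lemma cfZ a x i : cf (a *: x) i = a * cf x i.
Proof. by rewrite -[_ *: _]addr0 cf_lin cf0 addr0. Qed.

Lemma cfD x y i : cf (x + y) i = cf x i + cf y i.
Proof. by rewrite -[x in LHS]scale1r cf_lin mul1r. Qed.

Lemma cfB x y i : cf (x - y) i = cf x i - cf y i.
Proof. by rewrite addrC -scaleN1r cf_lin mulN1r addrC. Qed.

Lemma cf_bigsum (I : Type) (r : seq I) (P : pred I) (f : I -> E) k :
  cf (\sum_(i <- r | P i) f i) k = \sum_(i <- r | P i) cf (f i) k.
Proof. exact: (big_morph (fun x => cf x k) (fun x y => cfD x y k) (cf0 k)). Qed.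

Lemma cf_sum n (c : nat -> F) (a : nat -> E) i :
  cf (\sum_(k < n) c k *: a k) i = \sum_(k < n) c k * cf (a k) i.
Proof.
by rewrite cf_bigsum; apply: eq_bigr => k _; rewrite cfZ.
Qed.

Lemma cf_eq0 x : (forall i, cf x i = 0) -> x = 0.
Proof.
move=> x0; have [N [_ ->]] := cfP x.
by rewrite big1 // => i _; rewrite x0 scale0r.
Qed.

Definition lowspace n : set E := [set x | forall i, (n <= i)%N -> cf x i = 0].
Definition highspace n : set E := [set x | forall i, (i < n)%N -> cf x i = 0].

Lemma lowspace_subspace n : subspace (lowspace n).
Proof.
split=> [i _|a x y lx ly i ni]; first exact: cf0.
by rewrite cf_lin lx ?ly ?mulr0 ?addr0.
Qed.

Lemma lowspace_le m n : (m <= n)%N -> lowspace m `<=` lowspace n.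
Proof. by move=> mn x lx i ni; apply: lx; apply: leq_trans ni. Qed.

Lemma lowspace_ex x : exists n, lowspace n x.
Proof. by have [N [xN _]] := cfP x; exists N. Qed.

(** [lo] and [hi] search below a chosen bound of the support; their values at 0 carry no meaning. *)
Definition lo (x : E) : nat :=
  find (fun i => cf x i != 0) (iota 0 (projT1 (cid (lowspace_ex x)))).
Definition hi (x : E) : nat :=
  (\max_(i < projT1 (cid (lowspace_ex x)) | cf x i != 0%R) i)%N.

Lemma loP x : x != 0 -> cf x (lo x) != 0.
Proof.
rewrite /lo; case: (cid _) => N xN /= x0.
have h : has (fun i => cf x i != 0) (iota 0 N).
  apply: contraNT x0 => /hasPn nh; apply/eqP/cf_eq0 => i.
  case: (ltnP i N) => [iN|/xN//].
  by apply/eqP/negPn/nh; rewrite mem_iota.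
have := nth_find 0%N h; rewrite nth_iota //.
by rewrite -[X in (_ < X)%N](size_iota 0 N) -has_find.
Qed.

Lemma lo_min x : x != 0 -> highspace (lo x) x.
Proof.
rewrite /lo; case: (cid _) => N xN /= x0 i il.
have iN : (i < N)%N.
  by apply: leq_trans il _; rewrite -{2}(size_iota 0 N) find_size.
have := before_find 0%N il; rewrite nth_iota // add0n.
by move=> /negbT; rewrite negbK => /eqP.
Qed.

Lemma hiP x : x != 0 -> cf x (hi x) != 0.
Proof.
move=> x0; have lx := loP x0; rewrite /hi; case: (cid _) => N xN /=.
have lN : (lo x < N)%N by rewrite ltnNge; apply: contraNN lx => /xN ->.
have A0 : (0 < #|[pred i : 'I_N | cf x i != 0%R]|)%N.
  by apply/card_gt0P; exists (Ordinal lN).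
have [i xi iE] := eq_bigmax_cond (fun i : 'I_N => nat_of_ord i) A0.
by have -> : (\max_(i < N | cf x i != 0%R) i)%N = i by exact: iE.
Qed.

Lemma hi_max x : lowspace (hi x).+1 x.
Proof.
move=> i; rewrite /hi; case: (cid _) => N xN /= il.
case: (ltnP i N) => [iN|/xN//]; apply/eqP/negPn/negP => xi.
have := @leq_bigmax_cond _ (fun i : 'I_N => cf x i != 0) (fun i => nat_of_ord i) (Ordinal iN) xi.
by rewrite /= leqNgt il.
Qed.

Lemma lo_le x i : x != 0 -> cf x i != 0 -> (lo x <= i)%N.
Proof. by move=> x0; apply: contraNT; rewrite -ltnNge => /(lo_min x0) ->. Qed.

Lemma le_hi x i : cf x i != 0 -> (i <= hi x)%N.
Proof. by apply: contraNT; rewrite -ltnNge => /hi_max ->. Qed.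

Lemma lo_le_hi x : x != 0 -> (lo x <= hi x)%N.
Proof. by move=> x0; apply/le_hi/loP. Qed.

Lemma lo_eq x n : cf x n != 0 -> highspace n x -> lo x = n.
Proof.
move=> xn hx.
have x0 : x != 0 by apply: contraNneq xn => ->; rewrite cf0.
apply/eqP; rewrite eqn_leq lo_le //= leqNgt; apply/negP => /hx h.
by have := loP x0; rewrite h eqxx.
Qed.

Lemma highspace_lo n x : x != 0 -> highspace n x -> (n <= lo x)%N.
Proof.
move=> x0 hx; rewrite leqNgt; apply/negP => /hx h.
by have := loP x0; rewrite h eqxx.
Qed.

Lemma suppE x n : supp e x n <-> cf x n != 0.
Proof.
split=> [[N [c [xE nN cn]]]|xn].
  rewrite (@cf_uniq x (fun i => if (i < N)%N then c i else 0) N) ?nN // => [i|].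
    by rewrite ltnNge => ->.
  by rewrite xE; apply: eq_bigr => i _; rewrite ltn_ord.
have [N [xN xE]] := cfP x; exists N, (cf x); split=> //.
by rewrite ltnNge; apply: contraNN xn => /xN ->.
Qed.

Lemma block_ltE x y : block_lt e x y <-> [/\ x != 0, y != 0 & (hi x < lo y)%N].
Proof.
split=> [[m [n [[/suppE xm mu] [/suppE yn nl] mn]]]|[x0 y0 xy]].
  have x0 : x != 0 by apply: contraNneq xm => ->; rewrite cf0.
  have y0 : y != 0 by apply: contraNneq yn => ->; rewrite cf0.
  split=> //.
  have h1 : (hi x <= m)%N by apply: (mu (hi x)); apply/suppE/hiP.
  have h2 : (n <= lo y)%N by apply: (nl (lo y)); apply/suppE/loP.
  by apply: leq_ltn_trans h1 _; apply: leq_trans h2.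
exists (hi x), (lo y); split=> //; split.
- exact/suppE/hiP.
- by move=> i /suppE /le_hi.
- exact/suppE/loP.
- by move=> i /suppE /(lo_le y0).
Qed.

Lemma block_seqP a : block_seq e a <->
  (forall n, a n != 0) /\ forall n, (hi (a n) < lo (a n.+1))%N.
Proof.
split=> -[a0 alt]; split=> //.
  by move=> n; have /block_ltE[] := alt n n.+1 (ltnSn n).
move=> m n; elim: n => // n IH; rewrite ltnS leq_eqVlt => /orP[/eqP->|/IH].
  by apply/block_ltE.
move=> /block_ltE[_ _ mn]; apply/block_ltE; split=> //.
by apply: ltn_trans mn _; apply: leq_ltn_trans (alt n); apply: lo_le_hi.
Qed.

Lemma block_neq0 a n : block_seq e a -> a n != 0.
Proof. by case. Qed.

Lemma block_hi_lo a m n : block_seq e a -> (m < n)%N -> (hi (a m) < lo (a n))%N.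
Proof. by move=> [_ alt] /alt/block_ltE[]. Qed.

Lemma block_lo_incr a : block_seq e a -> incr (lo \o a).
Proof.
move=> ba n /=; apply: leq_ltn_trans (lo_le_hi (block_neq0 n ba)) _.
exact: block_hi_lo.
Qed.

Lemma block_hi_ge a n : block_seq e a -> (n <= hi (a n))%N.
Proof.
move=> ba; apply: leq_trans (incr_ge n (block_lo_incr ba)) _.
exact/lo_le_hi/block_neq0.
Qed.

Lemma block_comp a j : block_seq e a -> incr j -> block_seq e (a \o j).
Proof.
move=> ba ij; apply/block_seqP; split=> n /=; first exact: block_neq0.
exact: block_hi_lo.
Qed.

Lemma block_span_comp (a : nat -> E) j : block_span (a \o j) `<=` block_span a.
Proof. by apply: block_span_sub => n; apply: block_span_mem. Qed.

Lemma block_cf_top a n (c : nat -> F) : block_seq e a -> c n != 0 ->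
  cf (\sum_(i < n.+1) c i *: a i) (hi (a n)) != 0.
Proof.
move=> ba cn; rewrite cf_sum big_ord_recr /= big1 => [|i _].
  by rewrite add0r mulf_neq0 // hiP // block_neq0.
rewrite hi_max ?mulr0 //; apply: leq_trans (block_hi_lo ba (ltn_ord i)) _.
exact/lo_le_hi/block_neq0.
Qed.

(** Nothing cancels at the start of the first block with a nonzero coefficient. Hence a common block
    subspace forces the [lo] sets of two sequences to share an infinite subset, which is what labels
    detect. *)
Lemma block_span_lo a x : block_seq e a -> block_span a x -> x != 0 ->
  exists p, lo x = lo (a p).
Proof.
move=> ba /block_spanP[n [c ->]] x0.
have ex : exists p, (p < n)%N && (c p != 0).
  apply: contrapT => nex; move: x0; rewrite big1 ?eqxx // => i _.
  case: (eqVneq (c i) 0) => [->|ci]; first by rewrite scale0r.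
  by case: nex; exists i; rewrite ltn_ord.
case: (ex_minnP ex) => p /andP[pn cp] pmin.
have c0 i : (i < p)%N -> (i < n)%N -> c i = 0.
  move=> ip iN; apply/eqP/negPn/negP => ci.
  by have := pmin i; rewrite iN ci leqNgt ip => /(_ isT).
exists p; apply: lo_eq.
  rewrite cf_sum (bigD1 (Ordinal pn)) //= big1 => [|i ip].
    by rewrite addr0 mulf_neq0 // loP // block_neq0.
  case: (ltngtP i p) => [lt|lt|eq]; first by rewrite c0 ?mul0r.
    rewrite lo_min ?mulr0 ?block_neq0 //.
    exact: (incr_lt (block_lo_incr ba)).
  by move: ip; rewrite -val_eqE /= eq eqxx.
move=> k kp; rewrite cf_sum big1 // => i _.
case: (ltnP i p) => [lt|le]; first by rewrite c0 ?mul0r.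
rewrite lo_min ?mulr0 ?block_neq0 //.
by apply: leq_trans kp _; apply: (incr_le (block_lo_incr ba)).
Qed.

(** * Finite-dimensional, bounded and big subspaces *)

Definition bounded (W : set E) : Prop := exists n, W `<=` lowspace n.

Lemma finite_dimensional_bounded W : finite_dimensional W -> bounded W.
Proof.
move=> [S /finite_seqP[s ->] ->].
suff [n sn] : exists n, forall x, x \in s -> lowspace n x.
  by exists n; apply: lspan_min => //; apply: lowspace_subspace.
elim: s => [|x s [n IH]]; first by exists 0%N.
have [m xm] := lowspace_ex x; exists (maxn m n) => y; rewrite inE => /orP[/eqP->|/IH].
  exact: lowspace_le (leq_maxl _ _) _ xm.
exact: lowspace_le (leq_maxr _ _) _.
Qed.

Lemma bounded_finite_dimensional W :
  subspace W -> bounded W -> finite_dimensional W.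
Proof.
move=> + [n]; elim: n W => [|n IH] W sW Wn.
  exists set0 => //; apply/seteqP; split=> x.
    by move=> /Wn x0; rewrite (cf_eq0 (fun i => x0 i (leq0n i))); case: (lspan_subspace (@set0 E)).
  by apply: lspan_min.
case: (pselect (exists2 w, W w & cf w n != 0)) => [[w Ww wn]|nw]; last first.
  apply: IH => // x Wx i; rewrite leq_eqVlt => /orP[/eqP <-|]; last exact: Wn.
  by apply/eqP/negPn/negP => xn; apply: nw; exists x.
have [|x []//|S finS SE] := IH (W `&` lowspace n).
  by apply: subspaceI => //; apply: lowspace_subspace.
exists (w |` S); first by rewrite finite_setU; split.
have sS := lspan_subspace (w |` S).
apply/seteqP; split=> x.
  move=> Wx; rewrite -(subrK ((cf x n / cf w n) *: w) x).
  apply: subspaceD => //; last by apply: subspaceZ => //; apply: sub_lspan; left.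
  apply: (@lspan_min _ _ S) => //; first by move=> y Sy; apply: sub_lspan; right.
  rewrite -SE; split.
    by apply: subspaceB => //; apply: subspaceZ.
  move=> i; rewrite addrC -scaleNr cf_lin leq_eqVlt => /orP[/eqP <-|ni].
    by rewrite mulNr mulfVK ?addNr.
  by rewrite (Wn w Ww i ni) (Wn x Wx i ni) mulr0 addr0.
apply: lspan_min => // y [->//|Sy].
suff [] : (W `&` lowspace n) y by [].
by rewrite SE; apply: sub_lspan.
Qed.

(** Gaussian elimination from below: dropping one vanishing condition costs at most one extra vector
    [w]. *)
Lemma bounded_highspace W n : subspace W -> bounded (W `&` highspace n) -> bounded W.
Proof.
move=> sW; elim: n => [|n IH] bd.
  by case: bd => m bd; exists m => x Wx; apply: bd.
apply: IH; case: bd => m bd.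
case: (pselect (exists2 w, (W `&` highspace n) w & cf w n != 0)) => [[w [Ww hw] wn]|nw].
  have [k wk] := lowspace_ex w; exists (maxn m k) => x [Wx hx].
  have sl := lowspace_subspace (maxn m k).
  have wmk := lowspace_le (leq_maxr m k) wk.
  rewrite -(subrK ((cf x n / cf w n) *: w) x); apply: (subspaceD sl); last first.
    exact: (subspaceZ _ sl).
  apply: (lowspace_le (leq_maxl m k)); apply: (bd); split.
    by apply: subspaceB => //; apply: subspaceZ.
  move=> i; rewrite addrC -scaleNr cf_lin ltnS leq_eqVlt => /orP[/eqP->|lt].
    by rewrite mulNr mulfVK ?addNr.
  by rewrite (hw i lt) (hx i lt) mulr0 addr0.
exists m => x [Wx hx]; apply: bd; split=> // i; rewrite ltnS leq_eqVlt => /orP[/eqP->|/hx//].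
by apply/eqP/negPn/negP => xn; apply: nw; exists x.
Qed.

(** By [bounded_highspace], an unbounded subspace has nonzero vectors starting arbitrarily late;
    each is chosen past the [hi] of the previous one. *)
Lemma unbounded_big W : subspace W -> ~ bounded W -> big e W.
Proof.
move=> sW nb.
have /choice[g gP] n : exists x, [/\ W x, x != 0 & highspace n x].
  apply: contrapT => nx; apply: nb; apply: (@bounded_highspace _ n) => //.
  exists 0%N => x [Wx hx]; case: (eqVneq x 0) => [->|x0].
    by case: (lowspace_subspace 0).
  by case: nx; exists x.
pose a := fix a n := if n is m.+1 then g (hi (a m)).+1 else g 0%N.
exists a.
  apply/block_seqP; split=> [[|n]|n] /=.
  - by case: (gP 0%N).
  - by case: (gP (hi (a n)).+1).
  - by case: (gP (hi (a n)).+1) => _ x0 hx; apply: highspace_lo.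
apply: block_span_min => // -[|n] /=; first by case: (gP 0%N).
by case: (gP (hi (a n)).+1).
Qed.

Lemma big_unbounded W : big e W -> ~ bounded W.
Proof.
move=> [c bc cW] [n Wn].
have := hiP (block_neq0 n bc); rewrite (Wn (c n)) ?eqxx //.
  exact/cW/block_span_mem.
exact: block_hi_ge.
Qed.

Lemma almost_disjointE a b :
  almost_disjoint a b <-> bounded (block_span a `&` block_span b).
Proof.
split; first exact: finite_dimensional_bounded.
by apply: bounded_finite_dimensional; apply: subspaceI; apply: lspan_subspace.
Qed.

Lemma not_almost_disjoint a b : ~ almost_disjoint a b <->
  exists2 c, block_seq e c & block_span c `<=` block_span a `&` block_span b.
Proof.
split=> [nab|bg /almost_disjointE]; last exact: big_unbounded.
apply: unbounded_big; first by apply: subspaceI; apply: lspan_subspace.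
by move=> /almost_disjointE.
Qed.

End Coordinates.

(** * Avoiding few block subspaces *)

Lemma seq_of_bounded_uniq (P : set nat) K :
  (forall l, uniq l -> (forall k, k \in l -> P k) -> (size l <= K)%N) ->
  exists2 l, (size l <= K)%N & forall k, P k -> k \in l.
Proof.
move=> H; apply: contrapT => nl.
suff /(_ K.+1 (leqnn _)) [l [ul lP sl]] m : (m <= K.+1)%N ->
    exists l, [/\ uniq l, forall k, k \in l -> P k & size l = m].
  by have := H l ul lP; rewrite sl ltnn.
elim: m => [|m IH] mK; first by exists [::].
have [l [ul lP sl]] := IH (ltnW mK).
have [k [Pk kl]] : exists k, P k /\ k \notin l.
  apply: contrapT => nk; apply: nl; exists l => [|k Pk]; first by rewrite sl.
  by apply/negPn/negP => kl; apply: nk; exists k.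
exists (k :: l); split=> /=; rewrite ?kl ?sl // => k'.
by rewrite inE => /orP[/eqP->|/lP].
Qed.

Lemma lspan_seqP (F : fieldType) (E : lmodType F) (l : seq E) (x : E) :
  lspan [set` l] x -> exists c : 'rV[F]_(size l), x = \sum_i c 0 i *: l`_i.
Proof.
apply: (@lspan_min _ _ _
  [set x | exists c : 'rV[F]_(size l), x = \sum_i c 0 i *: l`_i]) => [|y /= yl].
  split; first by exists 0; rewrite big1 // => i _; rewrite mxE scale0r.
  move=> a _ _ [c ->] [d ->]; exists (a *: c + d).
  rewrite scaler_sumr -big_split; apply: eq_bigr => i _.
  by rewrite !mxE scalerDl scalerA.
have il : (index y l < size l)%N by rewrite index_mem.
exists (delta_mx 0 (Ordinal il)); rewrite (bigD1 (Ordinal il)) //= mxE !eqxx.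
rewrite scale1r nth_index // big1 ?addr0 // => i /negbTE ne.
by rewrite mxE ne andbF scale0r.
Qed.

Section Avoidance.
Variables (F : fieldType) (E : lmodType F) (e : nat -> E).
Hypothesis he : hamel_basis e.
Local Notation cf := (cf he).
Local Notation lo := (lo he).
Local Notation hi := (hi he).

Lemma lo_add x y : x != 0 -> y != 0 -> (hi x < lo y)%N -> lo (x + y) = lo x.
Proof.
move=> x0 y0 xy; apply: lo_eq.
  rewrite cfD (lo_min (he := he) y0) ?addr0 ?loP //.
  exact: leq_ltn_trans (lo_le_hi he x0) xy.
move=> i ilt; rewrite cfD (lo_min x0) // (lo_min (he := he) y0) ?addr0 //.
exact: ltn_trans (leq_trans ilt (lo_le_hi he x0)) xy.
Qed.

Lemma cf_hi_add x y : x != 0 -> y != 0 -> (hi x < lo y)%N ->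
  cf (x + y) (hi y) != 0.
Proof.
move=> x0 y0 xy; rewrite cfD (hi_max (he := he)) ?add0r ?hiP //.
exact: leq_trans xy (lo_le_hi he y0).
Qed.

Lemma hi_add x y : x != 0 -> y != 0 -> (hi x < lo y)%N -> hi (x + y) = hi y.
Proof.
move=> x0 y0 xy; apply/eqP; rewrite eqn_leq; apply/andP; split; last exact/le_hi/cf_hi_add.
have xy0 : x + y != 0.
  by apply: contraNneq (cf_hi_add x0 y0 xy) => ->; rewrite cf0.
rewrite leqNgt; apply/negP => lt; have := hiP he xy0.
rewrite cfD (hi_max (he := he) (x := x)) ?(hi_max (he := he) (x := y)) ?addr0 ?eqxx //.
exact: ltn_trans (leq_trans xy (lo_le_hi he y0)) lt.
Qed.

Lemma block_add a b : block_seq e a -> block_seq e b ->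
  (forall n, hi (a n) < lo (b n))%N -> (forall n, hi (b n) < lo (a n.+1))%N ->
  block_seq e (fun n => a n + b n).
Proof.
move=> ba bb ab ba'; apply/(block_seqP he); split=> n.
  apply: contraNneq (cf_hi_add (block_neq0 n ba) (block_neq0 n bb) (ab n)) => ->.
  by rewrite cf0.
by rewrite hi_add ?lo_add ?(block_neq0 _ ba) ?(block_neq0 _ bb).
Qed.

Lemma block_cf_lo a k k' : block_seq e a -> k != k' -> cf (a k') (lo (a k)) = 0.
Proof.
move=> ba; case: ltngtP => // lt _.
  apply: (lo_min (he := he)); first exact: (block_neq0 _ ba).
  exact: (incr_lt (block_lo_incr he ba)).
by apply: (hi_max (he := he)); apply: (block_hi_lo he ba lt).
Qed.

Lemma bounded_of_top (W : set E) c M : block_seq e c ->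
  (forall n (l : nat -> F), l n != 0 -> W (\sum_(i < n.+1) l i *: c i) -> (n < M)%N) ->
  bounded he (W `&` block_span c).
Proof.
move=> bc H; exists (hi (c M)).+1 => w [Ww cw].
have sl := lowspace_subspace he (hi (c M)).+1.
case: (eqVneq w 0) => [->|w0]; first by case: sl.
have [n [l [ln wE]]] := block_span_top cw w0; rewrite wE in Ww *.
apply: subspace_sum => // i _; apply: (subspaceZ _ sl).
have iM : (i < M)%N by apply: leq_ltn_trans (H n l ln Ww); rewrite -ltnS.
move: (hi_max (he := he) (x := c i)); apply: lowspace_le; rewrite ltnS.
by apply: leq_trans (ltnW (block_hi_lo he bc iM)) (lo_le_hi he (block_neq0 M bc)).
Qed.

(** The [b] part of a common vector lies in the span of [d], hence so does its [a] part, whose last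
    index is then bounded. *)
Lemma almost_disjoint_add a b d phi psi : block_seq e a -> incr phi ->
  block_seq e (fun n => a (phi n) + b (psi n)) ->
  block_span b `<=` block_span d -> almost_disjoint d a ->
  almost_disjoint d (fun n => a (phi n) + b (psi n)).
Proof.
move=> ba iphi bc bd /(almost_disjointE he)[N adN]; apply/(almost_disjointE he).
apply: (bounded_of_top (M := N.+1)) => // n l ln.
have -> : \sum_(i < n.+1) l i *: (a (phi i) + b (psi i)) =
    \sum_(i < n.+1) l i *: (a \o phi) i + \sum_(i < n.+1) l i *: b (psi i).
  by rewrite -big_split; apply: eq_bigr => i _; rewrite scalerDr.
set y := \sum_(i < _) _ *: (a \o phi) i; set z := \sum_(i < _) _ => dw.
have sd := lspan_subspace (range d); have sa := lspan_subspace (range a).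
have dz : block_span d z.
  apply: subspace_sum => // i _; apply: subspaceZ => //; apply: bd; exact: block_span_mem.
have dy : block_span d y by rewrite -(addrK z y); apply: subspaceB.
have ay : block_span a y.
  apply: subspace_sum => // i _; apply: subspaceZ => //; exact: block_span_mem.
have yN := adN y (conj dy ay).
have := block_cf_top he (block_comp he ba iphi) ln; rewrite ltnNge.
apply: contraNN => Nn; rewrite -/y yN // (leq_trans (ltnW Nn)) //.
exact: block_hi_ge (block_comp he ba iphi).
Qed.

(* Given the vectors already chosen, at most [size s + 1] choices of the next
   one can meet [A t + span]: a larger number would produce, by a linear
   dependence between their components in the span, an element of
   [A t] and the span of [V] with a nonzero coordinate beyond their
   intersection. *)
Lemma avoid_family (T : eqType) (X : set T) (A : T -> nat -> E) D V :
  unsplittable X -> (infinite_set X -> emb (X `*` X) X) ->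
  block_seq e D -> block_seq e V ->
  (forall t, X t -> almost_disjoint (A t) V) ->
  exists phi psi, [/\ incr phi, block_seq e (fun n => D (phi n) + V (psi n)),
    forall n, lo (D (phi n) + V (psi n)) = lo (D (phi n))
    & forall t, X t -> almost_disjoint (A t) (fun n => D (phi n) + V (psi n))].
Proof.
move=> uX sqX bD bV adV.
(* A state [s] lists the chosen indices of [V], latest first. The next term of [D] starts beyond the
   last used term of [V], and [off s] moves [V] beyond that term of [D]. *)
pose ph (s : seq nat) := if s is k :: _ then (hi (V k)).+1 else 0%N.
pose off s := (hi (D (ph s))).+1.
pose vec s k := D (ph s) + V k.
pose hist := fix hist (s : seq nat) : seq E :=
  if s is k :: s' then vec s' k :: hist s' else [::].
have size_hist s : size (hist s) = size s by elim: s => //= k s ->.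
have /choice[N NP] t : exists N, X t ->
    block_span (A t) `&` block_span V `<=` lowspace he N.
  case: (pselect (X t)) => [/adV/(almost_disjointE he)[N h]|nX]; last by exists 0%N.
  by exists N.
pose P t s : set nat := [set k | [/\ X t, (N t <= off s + k)%N &
  exists2 u, lspan [set` hist s] u & block_span (A t) (vec s (off s + k)%N + u)]].
have Psize t s l : uniq l -> (forall k, k \in l -> P t s k) -> (size l <= (size s).+1)%N.
  move=> ul lP; rewrite leqNgt; apply/negP => sl.
  pose n := size (hist s).
  have kP (i : 'I_n.+2) : P t s (nth 0%N l i).
    by apply/lP/mem_nth/(leq_trans (ltn_ord i)); rewrite /n size_hist.
  have Xt : X t by case: (kP 0).
  pose kk i := (off s + nth 0%N l i)%N.
  have /choice[u uP] (i : 'I_n.+2) : exists c : 'rV[F]_n,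
      block_span (A t) (vec s (kk i) + \sum_j c 0 j *: (hist s)`_j).
    have [_ _ [u /lspan_seqP[c ->] h]] := kP i; by exists c.
  (* With [n.+1] rows in dimension [n], some [mu] kills the [hist] components; the common term of
     [D] cancels in differences, so [z] lies in both spans. *)
  pose M := \matrix_(i < n.+1) (u (lift ord0 i) - u ord0).
  have [mu mu0 muM] : exists2 mu : 'rV[F]_n.+1, mu != 0 & mu *m M = 0.
    have : kermx M != 0.
      by rewrite kermx_eq0 /row_free neq_ltn ltnS rank_leq_col.
    move=> /rowV0Pn[v /sub_kermxP vM v0]; by exists v.
  pose z := \sum_i mu 0 i *: (V (kk (lift ord0 i)) - V (kk (@ord0 n.+1))).
  have zA : block_span (A t) z.
    have sA := lspan_subspace (range (A t)).
    pose w (i : 'I_n.+2) := vec s (kk i) + \sum_j u i 0 j *: (hist s)`_j.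
    have -> : z = \sum_i mu 0 i *: (w (lift ord0 i) - w ord0).
      have zero : \sum_i mu 0 i *: (\sum_j u (lift ord0 i) 0 j *: (hist s)`_j -
          \sum_j u ord0 0 j *: (hist s)`_j) = 0.
        transitivity (\sum_i \sum_j (mu 0 i * M i j) *: (hist s)`_j).
          apply: eq_bigr => i _; rewrite -sumrB scaler_sumr; apply: eq_bigr => j _.
          by rewrite !mxE -scalerBl scalerA.
        rewrite exchange_big big1 //= => j _; rewrite -scaler_suml.
        have := congr1 (fun m : 'rV_n => m 0 j) muM; rewrite mxE => ->.
        by rewrite mxE scale0r.
      rewrite /z -[LHS]addr0 -[X in _ + X]zero -big_split; apply: eq_bigr => i _ /=.
      rewrite -scalerDr; congr (_ *: _); rewrite /w /vec.
      rewrite [in RHS]opprD [in RHS]addrACA; congr (_ + _).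
      by rewrite opprD addrACA subrr add0r.
    apply: subspace_sum => // i _; apply: subspaceZ => //.
    by apply: subspaceB => //; apply: uP.
  have zV : block_span V z.
    have sV := lspan_subspace (range V).
    apply: subspace_sum => // i _; apply: subspaceZ => //.
    by apply: subspaceB => //; apply: block_span_mem.
  have zN := NP t Xt z (conj zA zV).
  have kk_inj (i j : 'I_n.+2) : kk i = kk j -> i = j.
    have ls (k : 'I_n.+2) : (k < size l)%N.
      by apply: leq_trans (ltn_ord k) _; rewrite /n size_hist.
    by move=> /addnI/eqP; rewrite nth_uniq // => /eqP/val_inj.
  case/negP: mu0; apply/eqP/rowP => i; rewrite mxE.
  have Nk : (N t <= lo (V (kk (lift ord0 i))))%N.
    have [_ h _] := kP (lift ord0 i); apply: leq_trans h _.
    exact: (incr_ge _ (block_lo_incr he bV)).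
  have k0 : kk (lift ord0 i) != kk (@ord0 n.+1).
    by apply/eqP => /kk_inj/eqP; rewrite eq_sym (negbTE (neq_lift _ _)).
  (* At this coordinate only the [i]-th summand of [z] can be nonzero, so [mu 0 i] vanishes. *)
  have := zN _ Nk; rewrite /z cf_bigsum (bigD1 i) // big1 => [|i' i'i].
    rewrite [LHS]addr0 cfZ cfB (block_cf_lo bV k0) subr0 => /eqP.
    by rewrite mulf_eq0 (negbTE (loP he (block_neq0 _ bV))) orbF => /eqP.
  rewrite cfZ cfB (block_cf_lo bV k0) (block_cf_lo bV) ?subr0 ?mulr0 //.
  by apply: contraNneq i'i => /kk_inj/lift_inj ->.
have /choice[l lP] (p : T * seq nat) : exists l, (size l <= (size p.2).+1)%N /\
    forall k, P p.1 p.2 k -> k \in l.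
  by have [l] := seq_of_bounded_uniq (@Psize p.1 p.2); exists l.
(* There are countably many states, and the evading function dictates the next choice at each of
   them. *)
have [G GP] := @slalom_evader T X (seq nat) (fun s => (size s).+1) uX sqX
  (fun t s => l (t, s)) (fun t s => (lP (t, s)).1).
pose sq := fix sq n := if n is m.+1 then (off (sq m) + G (sq m))%N :: sq m else [::].
pose phi n := ph (sq n); pose psi n := (off (sq n) + G (sq n))%N.
have size_sq n : size (sq n) = n by elim: n => //= n ->.
have DV n : (hi (D (phi n)) < lo (V (psi n)))%N.
  by apply: leq_trans (incr_ge _ (block_lo_incr he bV)); rewrite /psi leq_addr.
have VD n : (hi (V (psi n)) < lo (D (phi n.+1)))%N.
  exact: (incr_ge _ (block_lo_incr he bD)).
have iphi : incr phi.
  move=> n; rewrite -[phi n.+1]/(hi (V (psi n))).+1 ltnS.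
  apply: leq_trans (block_hi_ge he (phi n) bD) _.
  exact: leq_trans (ltnW (DV n)) (lo_le_hi he (block_neq0 _ bV)).
have ipsi : incr psi.
  move=> n; apply: leq_ltn_trans (block_hi_ge he (psi n) bV) _.
  apply: leq_trans (VD n) _; apply: leq_trans (lo_le_hi he (block_neq0 _ bD)) _.
  by rewrite /psi; apply: leq_trans (leqnSn _) (leq_addr _ _).
pose C n := D (phi n) + V (psi n).
have bC : block_seq e C.
  exact: block_add (block_comp he bD iphi) (block_comp he bV ipsi) DV VD.
exists phi, psi; split=> //.
  by move=> n; apply: lo_add; rewrite ?(block_neq0 _ bD) ?(block_neq0 _ bV) ?DV.
move=> t Xt; apply/(almost_disjointE he).
have [bad badP] := GP t Xt.
pose B := (\max_(s <- bad) size s)%N.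
apply: (bounded_of_top (M := (maxn B (N t)).+1) bC) => n c cn Aw.
rewrite ltnS leqNgt; apply/negP; rewrite gtn_max => /andP[Bn Nn].
suff : (n <= B)%N by rewrite leqNgt Bn.
have <- : size (sq n) = n by [].
rewrite /B (big_rem (sq n)) /= ?leq_maxl //; apply: badP.
apply: (lP (t, sq n)).2; split=> //=.
  by apply: leq_trans (ltnW Nn) _; apply: (incr_ge n ipsi).
(* Dividing by the top coefficient leaves the last vector plus a combination of earlier ones, so the
   choice made at [sq n] is a forbidden one. *)
exists ((c n)^-1 *: \sum_(i < n) c i *: C i).
  have sh := lspan_subspace [set` hist (sq n)].
  apply: subspaceZ => //; apply: subspace_sum => // i _; apply: subspaceZ => //.
  apply: sub_lspan => /=; elim: (n) (i) => [[]//|m IH [k /=]].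
  rewrite ltnS leq_eqVlt inE => /orP[/eqP->|km]; first by rewrite eqxx.
  by rewrite (IH (Ordinal km)) orbT.
have -> : vec (sq n) (off (sq n) + G (sq n))%N + (c n)^-1 *: \sum_(i < n) c i *: C i =
    (c n)^-1 *: \sum_(i < n.+1) c i *: C i.
  by rewrite big_ord_recr /= scalerDr scalerA mulVf // scale1r addrC.
by apply: subspaceZ => //; apply: lspan_subspace.
Qed.

End Avoidance.

(** * The recursion *)

Section Stage.
Variables (F : fieldType) (E : lmodType F) (e : nat -> E).
Hypothesis he : hamel_basis e.
Variables (K : eqType) (lt : K -> K -> Prop) (S : set K) (x : K -> nat -> bool).
Hypothesis spl : splitting lt S x.
Local Notation lo := (lo he).
Local Notation first_split := (first_split lt S x).
Local Notation extends := (extends lt S x).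

Lemma almost_disjoint_sym (a b : nat -> E) :
  almost_disjoint a b -> almost_disjoint b a.
Proof. by rewrite /almost_disjoint setIC. Qed.

Lemma almost_disjoint_subr (a b c : nat -> E) : block_span c `<=` block_span b ->
  almost_disjoint a b -> almost_disjoint a c.
Proof.
move=> cb /(almost_disjointE he)[n abn]; apply/(almost_disjointE he).
by exists n => w [aw cw]; apply: abn; split=> //; apply: cb.
Qed.

Lemma almost_disjoint_even_odd c : block_seq e c ->
  almost_disjoint (c \o (fun n => n.*2.+1)) (c \o double).
Proof.
move=> bc; apply: contrapT => /(not_almost_disjoint he)[d bd dsub].
have [d1 d2] := dsub _ (block_span_mem d 0); have d0 := block_neq0 0 bd.
have i1 : incr (fun n => n.*2.+1) by move=> n; lia.
have i2 : incr double by move=> n; lia.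
have [p ep] := block_span_lo he (block_comp he bc i1) d1 d0.
have [q eq] := block_span_lo he (block_comp he bc i2) d2 d0.
by have /(incr_inj (block_lo_incr he bc)) := etrans (esym ep) eq; lia.
Qed.

Lemma common_block_lo a d : block_seq e a -> block_seq e d ->
  block_span d `<=` block_span a -> forall n, exists p, (lo \o d) n = (lo \o a) p.
Proof.
move=> ba bd da n; apply: (block_span_lo he ba); first exact/da/block_span_mem.
exact: block_neq0 bd.
Qed.

(** The last clause leaves room beside [c]; it is used to show that the final family is infinite. *)
Definition good (P : set (nat -> E)) (Y : set E) (c : nat -> E) : Prop :=
  [/\ block_seq e c, block_span c `<=` Y,
      forall a, P a -> almost_disjoint a c,
      forall a, P a -> ~ extends (lo \o a) (lo \o c)
    & exists2 b, block_seq e b & almost_disjoint b c].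

(** Mutual extension means equal labels, so distinct members have distinct labels. *)
Definition stage_family (P : set (nat -> E)) : Prop :=
  [/\ P `<=` block_seq e, almost_disjoint_family P,
      forall a b, P a -> P b -> a <> b ->
        extends (lo \o a) (lo \o b) -> ~ extends (lo \o b) (lo \o a)
    & ~ emb [set: nat -> bool] P].

(** The even-indexed terms are kept, the odd-indexed ones witnessing the last clause of [good];
    thinning out further gives a label that no member of [P] extends. *)
Lemma good_disjoint P Y c : stage_family P ->
  block_seq e c -> block_span c `<=` Y -> (forall a, P a -> almost_disjoint a c) ->
  exists d, good P Y d.
Proof.
move=> [_ _ _ sm] bc cY adc.
have i2 : incr double by move=> n; lia.
have bc2 := block_comp he bc i2.
have [phi iphi ext] :=
  unextended_subseq spl (fun a => lo \o a) (block_lo_incr he bc2) sm.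
pose d := (c \o double) \o phi.
have d2 : block_span d `<=` block_span (c \o double) by apply: block_span_comp.
have dc : block_span d `<=` block_span c by apply: (@block_span_comp _ _ c (double \o phi)).
exists d; split=> //.
- exact: block_comp.
- by move=> y /dc /cY.
- by move=> a /adc; apply: almost_disjoint_subr.
exists (c \o (fun n => n.*2.+1)); first by apply: block_comp => // n; lia.
exact: almost_disjoint_subr d2 (almost_disjoint_even_odd bc).
Qed.

(* Members of [P] not almost disjoint from a vector sequence with the same
   [lo]-set as [D] have their labels among the proper initial segments of the
   label of [D]; there are too few of them to obstruct [avoid_family]. *)
Lemma good_two P Y a0 b0 : stage_family P -> subspace Y ->
  P a0 -> P b0 -> a0 <> b0 ->
  big e (Y `&` block_span a0) -> big e (Y `&` block_span b0) ->
  exists c, good P Y c.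
Proof.
move=> [Pb Pad Pext sm] sY Pa0 Pb0 ab [c0 bc0 c0sub] [V bV Vsub].
have [phi0 iphi0 extD] :=
  unextended_subseq spl (fun a => lo \o a) (block_lo_incr he bc0) sm.
pose D := c0 \o phi0.
have bD : block_seq e D := block_comp he bc0 iphi0.
have Dsub n : (Y `&` block_span a0) (D n) by apply/c0sub/block_span_mem.
have DY n : Y (D n) by case: (Dsub n).
have Da0 : block_span D `<=` block_span a0.
  by apply: block_span_sub => n; case: (Dsub n).
have VY n : Y (V n) by case: (Vsub _ (block_span_mem V n)).
have Vb0 : block_span V `<=` block_span b0 by move=> v /Vsub[].
have iD := block_lo_incr he bD.
have [k fk] := first_split_ex spl iD.
pose rel a h := [/\ P a, a <> b0, first_split (lo \o a) h &
  forall h', lt h' h -> exists2 i, ev_const (x h') (lo \o D) i &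
    ev_const (x h') (lo \o a) i].
have rel_ext a a' h : rel a h -> rel a' h -> extends (lo \o a) (lo \o a').
  move=> [Pa _ fa ra] [Pa' _ fa' ra'] k' h' fk' h'k'.
  have ekh := first_split_uniq spl fk' fa'; rewrite ekh in h'k'.
  have [i Di ai] := ra _ h'k'; have [i' Di' ai'] := ra' _ h'k'.
  by exists i => //; rewrite (ev_const_fun Di Di').
have rel_uniq a a' h : rel a h -> rel a' h -> a = a'.
  move=> ra ra'; apply: contrapT => ne.
  apply: (Pext a a') => //; [by case: ra|by case: ra'|exact: rel_ext ra ra'|].
  exact: rel_ext ra' ra.
(* [A h] is the unique member related to [h], if any, with default [a0]. *)
have /choice[A AP] h : exists a, [/\ P a, a <> b0 & forall a', rel a' h -> a = a'].
  case: (pselect (exists a, rel a h)) => [[a ra]|na].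
    exists a; split; [by case: ra|by case: ra|by move=> a'; apply: rel_uniq].
  by exists a0; split=> // a' ra'; case: na; exists a'.
have [wo dS _ us] := spl; have [Sk _ _] := fk.
have adV h : seg lt k h -> almost_disjoint (A h) V.
  move=> _; have [Ph nb _] := AP h.
  exact: almost_disjoint_subr Vb0 (Pad _ _ Ph Pb0 nb).
have [phi [psi [iphi bC loC adC]]] :=
  avoid_family he (us k Sk) (seg_square wo (x := k)) bD bV adV.
pose C n := D (phi n) + V (psi n).
have iC := block_lo_incr he bC.
have CD n : exists p, (lo \o C) n = (lo \o D) p by exists (phi n); apply: loC.
have adPC a : P a -> almost_disjoint a C.
  (* The span of [b0] contains [V], so [b0] is treated apart, using that it is almost disjoint from
     [D], which lies in [a0]. *)
  move=> Pa; case: (pselect (a = b0)) => [->|nb].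
    apply: (almost_disjoint_add he bD iphi bC Vb0).
    by apply: almost_disjoint_subr Da0 _; apply: Pad => // /esym.
  apply: contrapT => nad; have [d bd dsub] := (not_almost_disjoint he _ _).1 nad.
  have da n := common_block_lo (Pb a Pa) bd (fun v dv => (dsub v dv).1) n.
  have dD n : exists p, (lo \o d) n = (lo \o D) p.
    have [p ->] := common_block_lo bC bd (fun v dv => (dsub v dv).2) n.
    exact: CD.
  have [h hk [fh rh]] := compatible_first_split spl iD
    (block_lo_incr he (Pb a Pa)) (block_lo_incr he bd) dD da fk (extD a Pa).
  have [_ _ /(_ a) Aa] := AP h.
  by apply: nad; rewrite -Aa //; apply: adC.
exists C; split=> //.
- by apply: block_span_min => // n; apply: subspaceD.
- by move=> a Pa /(extends_sub spl iD iC CD); apply: extD.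
- by exists a0; [apply: Pb|apply: adPC].
Qed.

End Stage.

(** * Enumeration of the subsets of [E] *)

Lemma enumeration_ex (T : Type) (code : T -> nat -> bool) : injective code ->
  exists (lt : (nat -> bool) -> (nat -> bool) -> Prop) S (th : T -> nat -> bool),
  [/\ strict_wo lt, forall a b, lt a b -> S b -> S a,
      injective th, forall t, S (th t)
    & forall k, S k -> ~ emb [set: nat -> bool] (seg lt k)].
Proof.
move=> ci; have [lt wo] := strict_wo_ex (nat -> bool); exists lt.
have [mn tr _] := wo.
(* Truncating at the least segment that embeds the continuum, if any, keeps all proper segments
   smaller. *)
case: (pselect (exists k, emb [set: nat -> bool] (seg lt k))) => [ex|nex].
  have [k [f fk fi] kmin] := mn [set k | emb [set: nat -> bool] (seg lt k)] ex.
  exists (seg lt k), (f \o code); split=> //.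
  - by move=> a b ab bk; apply: tr bk.
  - by move=> s t /fi h; apply: ci; apply: h.
  - by move=> t; apply: fk.
  - by move=> a ak /kmin.
exists setT, code; split=> // k _ ek; apply: nex; by exists k.
Qed.

Section Countable.
Variables (F : fieldType) (E : lmodType F) (e : nat -> E).
Hypothesis hF : countable [set: F].
Hypothesis he : hamel_basis e.

Lemma vector_code : exists iota : E -> nat, injective iota.
Proof.
have /countable_injP[f fi] := hF.
have finj : injective f by move=> a b; apply: fi; rewrite inE.
have /choice[N NP] v : exists n, lowspace he n v := lowspace_ex he v.
exists (fun v => pickle [seq f (cf he v i) | i <- iota 0 (N v)]) => v w.
move=> /(pcan_inj pickleK) vw.
have eN : N v = N w by have := congr1 size vw; rewrite !size_map !size_iota.
apply/eqP; rewrite -subr_eq0; apply/eqP; apply: (cf_eq0 (he := he)) => i.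
rewrite cfB; apply/eqP; rewrite subr_eq0; apply/eqP.
case: (ltnP i (N v)) => [iN|Ni]; last by rewrite (NP v) // (NP w) // -eN.
have := congr1 (fun s => nth 0%N s i) vw.
rewrite !(nth_map 0%N) ?size_iota -?eN // !nth_iota -?eN //.
exact: finj.
Qed.

Lemma subset_code : exists code : set E -> nat -> bool, injective code.
Proof.
have [f fi] := vector_code.
exists (fun Y n => `[< exists2 v, Y v & f v = n >]) => Y Z YZ.
apply/seteqP; split=> v; move: (congr1 (fun g => g (f v)) YZ) => /= h Yv.
  have /asboolP[w Zw /fi <-//] : `[< exists2 w, Z w & f w = f v >].
  by rewrite -h; apply/asboolP; exists v.
have /asboolP[w Zw /fi <-//] : `[< exists2 w, Y w & f w = f v >].
by rewrite h; apply/asboolP; exists v.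
Qed.

Lemma block_seq_ex : exists b, block_seq e b.
Proof.
have [||b bb _] := @unbounded_big _ _ _ he [set: E].
- by split.
- move=> [n /(_ (e n) I)] /(_ n (leqnn n)).
  rewrite (@cf_uniq _ _ _ he _ (fun i => (i == n)%:R) n.+1) ?eqxx.
  + by move/eqP; rewrite oner_eq0.
  + by move=> i ni; rewrite gtn_eqF.
  + rewrite big_ord_recr /= eqxx scale1r big1 ?add0r // => i _.
    by rewrite ltn_eqF ?scale0r.
by exists b.
Qed.

End Countable.

Lemma infinite_cantor : infinite_set [set: nat -> bool].
Proof.
apply: (@emb_infinite nat _ setT) infinite_nat.
exists (fun n m => n == m) => // m n _ _ /(congr1 (fun g => g n)).
by rewrite eqxx => /eqP.
Qed.

(* As usual for mad families, the family is required to be infinite; otherwise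
   the singleton family consisting of the basis would be a trivial witness. *)
Theorem theorem1p6 (F : fieldType) (E : lmodType F) (e : nat -> E)
    (hF : countable [set: F]) (he : hamel_basis e) :
  exists A : set (nat -> E),
    [/\ infinite_set A, mad e A & completely_separable e A].
Proof.
have [lt0 [S0 [x spl]]] := splitting_ex.
have [code codei] := subset_code hF he.
have [lt [S [th [wo dS thi thS sm]]]] := enumeration_ex codei.
have [_ _ tot] := wo.
have /choice[Yof YofP] k : exists Y : set E, forall Z, th Z = k -> Y = Z.
  case: (pselect (exists Z, th Z = k)) => [[Z <-]|nZ].
    by exists Z => Z' /thi.
  by exists set0 => Z eZ; case: nZ; exists Z.
pose gd := good he lt0 S0 x.
pose step (P : set (nat -> E)) (Y : set E) : option (nat -> E) :=
  match pselect (exists c, gd P (lspan Y) c) with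
  | left h => Some (projT1 (cid h))
  | right _ => None
  end.
have stepS P Y c : step P Y = Some c -> gd P (lspan Y) c.
  by rewrite /step; case: pselect => // h [<-]; case: (cid h).
have stepN P Y : step P Y = None -> ~ exists c, gd P (lspan Y) c.
  by rewrite /step; case: pselect.
pose fam := Fix (strict_wo_wf wo) (fun _ => option (nat -> E)) (fun k rec =>
  step [set a | exists j, exists h : lt j k, rec j h = Some a] (Yof k)).
pose prev k : set (nat -> E) := [set a | exists2 j, lt j k & fam j = Some a].
have famE k : fam k = step (prev k) (Yof k).
  rewrite /fam Fix_eq -/fam => [|j f g fg].
    congr (step _ _); apply/seteqP; split=> a.
      by move=> [j [jk ja]]; exists j.
    by move=> [j jk ja]; exists j, jk.
  congr (step _ _); apply/seteqP; split=> a [i [h ia]]; exists i, h.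
    by rewrite -fg.
  by rewrite fg.
pose All : set (nat -> E) := [set a | exists2 k, S k & fam k = Some a].
have famP k c : fam k = Some c -> gd (prev k) (lspan (Yof k)) c.
  by rewrite famE => /stepS.
have prevAll k : S k -> prev k `<=` All.
  by move=> Sk a [j jk ja]; exists j => //; apply: dS jk Sk.
have blk k c : fam k = Some c -> block_seq e c by move=> /famP[].
have famlt j k a b : lt j k -> fam j = Some a -> fam k = Some b ->
    almost_disjoint a b /\ ~ extends lt0 S0 x (lo he \o a) (lo he \o b).
  move=> jk ja /famP[_ _ ad ne _].
  by split; [apply: ad|apply: ne]; exists j.
have famne j k a b : a <> b -> fam j = Some a -> fam k = Some b ->
    almost_disjoint a b /\ (extends lt0 S0 x (lo he \o a) (lo he \o b) ->
      ~ extends lt0 S0 x (lo he \o b) (lo he \o a)).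
  move=> ab ja kb; case: (tot j k) => [jk|[jk|kj]].
  - by have [ad ne] := famlt _ _ _ _ jk ja kb; split.
  - by case: ab; move: ja; rewrite jk kb => -[].
  - have [ad ne] := famlt _ _ _ _ kj kb ja; split=> //.
    exact: almost_disjoint_sym.
have AllAd : almost_disjoint_family All.
  by move=> a b [j _ ja] [k _ kb] ab; case: (famne _ _ _ _ ab ja kb).
have stage P : P `<=` All -> ~ emb [set: nat -> bool] P ->
    stage_family he lt0 S0 x P.
  move=> PA nemb; split=> //.
  - by move=> a /PA[k _ /blk].
  - by move=> a b /PA Aa /PA Ab; apply: AllAd.
  - move=> a b /PA[j _ ja] /PA[k _ kb] ab.
    by case: (famne _ _ _ _ ab ja kb).
(* Each stage adds at most one member, so [prev k] embeds in [seg lt k]. *)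
have prev_small k : S k -> ~ emb [set: nat -> bool] (prev k).
  move=> Sk pk; apply: (sm k Sk); apply: emb_trans pk _.
  have /choice[ix ixP] a : exists j, prev k a -> lt j k /\ fam j = Some a.
    case: (pselect (prev k a)) => [[j jk ja]|na]; first by exists j.
    by exists k => /na.
  exists ix => [a /ixP[]//|a b /ixP[_ ia] /ixP[_ ib] ab].
  by move: ia; rewrite ab ib => -[].
have stage_prev k : S k -> stage_family he lt0 S0 x (prev k).
  by move=> Sk; apply: stage; [apply: prevAll|apply: prev_small].
have added Z : (exists c, gd (prev (th Z)) (lspan Z) c) ->
    exists2 c, All c & block_span c `<=` lspan Z.
  move=> ex; have YZ := YofP _ Z erefl.
  case E1: (fam (th Z)) => [c|].
    exists c; first by exists (th Z).
    by have [_] := famP _ _ E1; rewrite YZ.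
  by move: E1; rewrite famE YZ => /stepN.
have madA : mad e All.
  (* If [b] were almost disjoint from all members, the stage of [range b] would have added a member
     inside its span. *)
  split=> // [a [k _ /blk]//|[b [bb adb]]].
  have [|c Ac cb] := added (range b).
    apply: (good_disjoint spl (stage_prev _ (thS _)) bb) => // a.
    by move=> /(prevAll _ (thS _)); apply: adb.
  apply/(not_almost_disjoint he c b): (adb c Ac).
  have [k _ /blk bc] := Ac.
  by exists c => // v cv; split=> //; apply: cb.
have bigT a : All a -> big e (setT `&` block_span a).
  by move=> [k _ /blk ba]; exists a => // v; split.
exists All; split=> //.
  (* A finite family would itself be a legitimate stage. It has two members, since some [b] is
     almost disjoint from [a] and must meet another one; [good_two] then contradicts maximality. *)
  move=> finA; have [_ _ nomore] := madA.
  have meet b : block_seq e b -> exists2 a, All a & ~ almost_disjoint a b.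
    move=> bb; apply: contrapT => na; apply: nomore; exists b; split=> // a Aa.
    by apply: contrapT => nad; apply: na; exists a.
  have [b0 bb0] := block_seq_ex he.
  have [a Aa _] := meet b0 bb0.
  have [k _ ka] := Aa; have [_ _ _ _ [b bb ba]] := famP _ _ ka.
  have [a' Aa' na'] := meet b bb.
  have aa' : a <> a' by move=> h; apply: na'; rewrite -h; apply: almost_disjoint_sym.
  have stA : stage_family he lt0 S0 x All.
    by apply: stage => // /emb_infinite/(_ infinite_cantor).
  have [|c [bc _ adc _ _]] := good_two spl stA _ Aa Aa' aa' (bigT _ Aa) (bigT _ Aa').
    by split.
  by apply: nomore; exists c.
move=> Z infZ; apply: added; apply: contrapT => nadd.
(* If [a] were not an earlier member, its intersection with the span of [Z] would contain a block
   sequence almost disjoint from all earlier members. *)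
have inprev a : All a -> big e (lspan Z `&` block_span a) -> prev (th Z) a.
  move=> Aa [c bc cs]; apply: contrapT => npa; apply: nadd.
  apply: (good_disjoint spl (stage_prev _ (thS Z)) bc) => [v /cs[]//|a' pa'].
  apply: (almost_disjoint_subr he (b := a)) => [v /cs[]//|].
  by apply: AllAd => [|//|h]; [apply: prevAll pa'|apply: npa; rewrite -h].
have [a [Aa ba]] := infinite_setN0 infZ.
have [b [[Ab bb] ab]] : exists b, (All b /\ big e (lspan Z `&` block_span b)) /\ a <> b.
  apply: contrapT => nb; apply: infZ; apply: sub_finite_set (finite_set1 a) => b Hb /=.
  by apply: contrapT => ne; apply: nb; exists b; split=> // /esym.
apply: nadd; apply: (good_two spl (stage_prev _ (thS Z)) _ _ _ ab ba bb).
- exact: lspan_subspace.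
- exact: inprev.
- exact: inprev.
Qed.
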